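(* Let $k$ be a field and let $A$ be a finitely generated prime monomial $k$-algebra of quadratic growth. Then $A$ has bounded matrix images, and either $A$ is primitive or $A$ has nonzero locally nilpotent Jacobson radical.
   Context: Algebras are associative and unital. A monomial algebra is an algebra $A\cong k\{x_1,\ldots,x_d\}/I$ where $k\{x_1,\ldots,x_d\}$ is the free algebra and $I$ is an ideal generated by monomials (words) in $x_1,\ldots,x_d$. A frame of a finitely generated $k$-algebra $A$ is a finite-dimensional $k$-subspace $V$ of $A$ with $1\in V$ that generates $A$ as a $k$-algebra. $A$ has quadratic growth if there exist a frame $V$ of $A$ and constants $C_1,C_2>0$ with $C_1n^2\le \dim_k(V^n)\le C_2n^2$ for all $n\ge 1$. $A$ has bounded matrix images if there is a positive integer $N$ such that every prime homomorphic image of $A$ that is finite-dimensional over $k$ satisfies the standard identity $S_{2N}$ (equivalently, has PI degree at most $N$). An ideal is locally nilpotent if every finitely generated (non-unital) subalgebra of it is nilpotent. *)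

(* Defs.v *)
From HB Require Import structures.
From mathcomp Require Import all_boot all_order all_algebra all_fingroup.
From mathcomp Require Import falgebra.
From mathcomp Require Import boolp classical_sets reals.
From mathcomp.multinomials Require Import monalg.

Set Implicit Arguments.
Unset Strict Implicit.
Unset Printing Implicit Defensive.

Import GRing.Theory.
Local Open Scope classical_set_scope.
Local Open Scope ring_scope.

(* [GRing.submod_closed] and its variants are stated for boolean predicates;
   a [set] is seen as one by [mem]. *)
Definition submodule (R : nzRingType) (M : lmodType R) (U : set M) : Prop :=
  GRing.submod_closed (mem U).

Section Rings.
Variable R : nzRingType.
Implicit Types I J : set R.

(* A left ideal is a submodule of the left regular module. *)
Definition left_ideal I : Prop := @submodule R R^o I.

Definition two_sided_ideal I : Prop :=
  left_ideal I /\ forall x r : R, I x -> I (x * r).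

(* The hypothesis [x * y = 0] for all [x] in [I] and [y] in [J] says that the
   product ideal [IJ] is zero; the ring is nonzero because of [nzRingType]. *)
Definition prime_ring : Prop :=
  forall I J, two_sided_ideal I -> two_sided_ideal J ->
    (forall x y : R, I x -> J y -> x * y = 0) -> I = [set 0] \/ J = [set 0].

Definition simple_module (M : lmodType R) : Prop :=
  (exists m : M, m <> 0) /\
  forall U : set M, submodule U -> U = [set 0] \/ U = setT.

Definition faithful_module (M : lmodType R) : Prop :=
  forall r : R, (forall m : M, r *: m = 0) -> r = 0.

(* Primitive means left primitive. *)
Definition primitive_ring : Prop :=
  exists M : lmodType R, simple_module M /\ faithful_module M.

Definition maximal_left_ideal I : Prop :=
  [/\ left_ideal I, I <> setT &
      forall J, left_ideal J -> I `<=` J -> J = I \/ J = setT].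

Definition jacobson_radical : set R := \bigcap_(I in maximal_left_ideal) I.

Definition standard_identity (m : nat) : Prop :=
  forall a : 'I_m -> R,
    \sum_(s : 'S_m) (-1) ^+ s * \prod_(i < m) a (s i) = 0.

End Rings.

Arguments jacobson_radical R : clear implicits.

Section VectorSpaces.
Variables (k : fieldType) (M : lmodType k).

(* Subspaces of a possibly infinite-dimensional space: [has_dim U m] holds when
   [U] is a subspace with a basis of [m] vectors. *)
Definition has_dim (U : set M) (m : nat) : Prop :=
  exists b : 'I_m -> M,
    (forall c : 'I_m -> k, \sum_(i < m) c i *: b i = 0 -> forall i, c i = 0) /\
    U = [set \sum_(i < m) c i *: b i | c in [set: 'I_m -> k]].

End VectorSpaces.

Section Algebras.
Variables (k : fieldType) (A : algType k).
Implicit Types (V B I : set A) (s : seq A).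

Definition subalgebra B : Prop := GRing.subalg_closed (mem B).

Definition nonunital_subalgebra B : Prop :=
  submodule B /\ GRing.mulr_2closed (mem B).

Definition finitely_generated_algebra : Prop :=
  exists s, smallest subalgebra [set` s] = setT.

Definition frame V : Prop :=
  [/\ exists m, has_dim V m, V 1 & smallest subalgebra V = setT].

Definition subspace_pow V (n : nat) : set A :=
  smallest (@submodule k A)
    [set \prod_(i < n) v i | v in [set v : 'I_n -> A | forall i, V (v i)]].

Definition quadratic_growth (R : realType) : Prop :=
  exists2 V, frame V &
  exists C1 C2 : R,
    [/\ 0 < C1, 0 < C2 &
        forall n : nat, (1 <= n)%N ->
          exists2 m, has_dim (subspace_pow V n) m &
            C1 * n%:R ^+ 2 <= m%:R <= C2 * n%:R ^+ 2].

(* [{malg k[{fmonom 'I_d}]}] is the free algebra on [d] noncommuting variables,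
   [{fmonom 'I_d}] being the free monoid of words; [mkmalgU w 1] is the word [w]
   as an element of it. [A] is its quotient by the kernel of [f]. *)
Definition monomial_algebra : Prop :=
  exists (d : nat) (S : set {fmonom 'I_d})
         (f : {lrmorphism {malg k[{fmonom 'I_d}]} -> A}),
    (forall a : A, exists p, f p = a) /\
    f @^-1` [set 0] =
      smallest (@two_sided_ideal {malg k[{fmonom 'I_d}]})
               [set mkmalgU w (1 : k) | w in S].

(* [falgType k] is the type of finite-dimensional [k]-algebras. *)
Definition bounded_matrix_images : Prop :=
  exists2 N : nat, (0 < N)%N &
    forall (B : falgType k) (f : {lrmorphism A -> B}),
      (forall b : B, exists a, f a = b) -> prime_ring B ->
      standard_identity B (2 * N).

Definition nilpotent_subalgebra B : Prop :=
  exists2 n : nat, (0 < n)%N &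
    forall v : 'I_n -> A, (forall i, B (v i)) -> \prod_(i < n) v i = 0.

Definition locally_nilpotent I : Prop :=
  forall s, [set` s] `<=` I ->
    nilpotent_subalgebra (smallest nonunital_subalgebra [set` s]).

End Algebras.

(* Main.v *)
From HB Require Import structures.
Require Import Defs.
From mathcomp Require Import all_boot all_order all_algebra all_fingroup.
From mathcomp Require Import zify.
From mathcomp Require Import falgebra finmap.
From mathcomp Require Import boolp classical_sets reals.
From mathcomp.multinomials Require Import monalg.

(** A monomial algebra [A] has a basis of words, indexed by a language [L] that
    is closed under factors, and a product of basis words is a basis word or zero.
    Primeness of [A] says that [L] is recurrent: any two words of [L] occur, in
    this order, in a third one.  Quadratic growth bounds the number of words of
    length at most [n] by a multiple of [n ^ 2], and [L] does not grow linearly.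
    Everything is deduced from the minimal infinite factor-closed languages [K]
    contained in [L].  Long words of such a [K] contain any given word of [K].

    There are only finitely many of them ([finitely_many_minimal]).  Two of them
    have no long words in common, and unless it is equal to [L] each has, in every
    large length, a word that extends to the left in two ways inside [L], because
    otherwise no word of [L] could lead out of it.  Hence the number of words of
    length [n] eventually increases by at least the number of minimal languages
    at every step, and quadratic growth bounds that number.

    Quadratic growth also excludes two different words of the same length that can
    replace one another independently at linearly many places
    ([no_free_exchange]).  This is used twice, to force words to commute.

    Bounded matrix images.  Let [B] be a prime finite-dimensional image of [A] and
    [w] a word whose image has minimal nonzero rank.  If [w x w] is nonzero in [B],
    then left multiplication by [w x] permutes the right ideal [w B], so all
    products of words [w x] of this kind are nonzero.  By the exchange principle
    they commute, which makes the language of [B] periodic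
    ([prime_image_periodic]).  A periodic recurrent language is minimal, so the
    period is bounded independently of [B].  If [n] is a period, the sum of all
    words of length [n] is central in [B], and [B] is spanned over its center by
    the words of length less than [2 * n]; a standard identity follows because the
    standard polynomial is alternating and multilinear over the center.

    The radical.  Let [f] be in the Jacobson radical and suppose that some word of
    a minimal language [K] occurs in it.  Multiplying by words on both sides, one
    may assume that the words of [K] occurring in [f] all have the same contexts in
    [K].  If there is only one of them, then, up to words outside [K], the radical
    contains the sum [g] of all words of [K] of some length.  If there are several,
    the exchange principle shows that, after multiplication by a word on the right,
    they commute with a common word [v] all of whose powers are in [K]
    ([ideal_dichotomy]).  In both cases one finds [g] in the radical with [1 - g]
    not left invertible: an inverse would have infinite support, respectively
    contradict a degree count among the words commuting with [v].  Hence only words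
    that lie in no minimal language occur in elements of the radical.  Products of
    many words taken from a finite set of such words vanish, as otherwise their
    factors would contain a minimal language; so these words span a locally
    nilpotent ideal, and it is the radical.

    If [L] is not minimal, a word of [L] avoiding each of the finitely many minimal
    languages exists by recurrence, and the radical is nonzero and locally
    nilpotent.  If [L] is minimal, it is not periodic because of its growth, so
    the second case of the dichotomy does not occur and every nonzero ideal contains
    a power of the sum [a] of the letters.  Since [1 - a] is not left invertible, a
    maximal left ideal containing it contains no nonzero ideal, and [A] is
    primitive ([minimal_lang_primitive]). *)

Set Implicit Arguments.
Unset Strict Implicit.
Unset Printing Implicit Defensive.

Import Order.TTheory GRing.Theory Num.Theory.
Local Open Scope classical_set_scope.
Local Open Scope nat_scope.

(** * Words: periods and commutation *)

Section Words.
Variable T : finType.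
Implicit Types (u v w : seq T) (n : nat).

Definition commutes u v : Prop := u ++ v = v ++ u.

Definition wpow v n : seq T := flatten (nseq n v).

Definition period n w : Prop :=
  forall x0 i, i + n < size w -> nth x0 w (i + n) = nth x0 w i.

Lemma period_infix n u w : infix u w -> period n w -> period n u.
Proof.
case/infixP => p [q ->] pw x0 i lt_i.
have lt1 : i < size u by lia.
have := pw x0 (size p + i); rewrite !size_cat -addnA !nth_cat.
rewrite !ltnNge !leq_addr /= !addKn -!ltnNge lt_i lt1; apply; lia.
Qed.

Lemma commutes_period u v : commutes u v -> period (size v) u.
Proof.
move=> uv x0 i lt_i; have lt1 : i < size u by lia.
have <- : nth x0 (u ++ v) (i + size v) = nth x0 u (i + size v).
  by rewrite nth_cat lt_i.
by rewrite uv nth_cat ltnNge leq_addl /= addnK.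
Qed.

Lemma period_eq n u w : 0 < n -> period n u -> period n w ->
  size u = size w -> take n u = take n w -> u = w.
Proof.
move=> n_gt0 pu pw Euw Et.
case: u => [|x0 u'] in pu Euw Et *; first by case: (w) Euw.
set u := x0 :: u' in pu Euw Et *; apply: (@eq_from_nth _ x0) => // i.
elim/ltn_ind: i => i IHi lt_i; have [lt_in|le_ni] := ltnP i n.
  by rewrite -(nth_take _ lt_in) Et nth_take.
rewrite -(subnK le_ni) pu ?pw; [|lia|lia]; apply: IHi; lia.
Qed.

Lemma commutes_sym u v : commutes u v -> commutes v u.
Proof. exact: esym. Qed.

Lemma commutes_cat u v w : commutes u v -> commutes w v -> commutes (u ++ w) v.
Proof. by rewrite /commutes => uv wv; rewrite -catA wv catA uv -catA. Qed.

Lemma commutes_wpow u v n : commutes u v -> commutes (wpow u n) v.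
Proof.
by move=> uv; elim: n => [|n IHn]; [exact: esym (cats0 _)|exact: commutes_cat].
Qed.

Lemma cat_injl u v w : u ++ w = v ++ w -> u = v.
Proof. by move/(congr1 rev); rewrite !rev_cat => /eqP; rewrite eqseq_cat // eqxx => /eqP /(can_inj revK). Qed.

Lemma cat_injr u v w : u ++ v = u ++ w -> v = w.
Proof. by move/eqP; rewrite eqseq_cat // eqxx => /eqP. Qed.

Lemma commutes_catl_cancel u v w :
  commutes (u ++ w) v -> commutes w v -> commutes u v.
Proof.
rewrite /commutes => uwv wv; apply: (@cat_injl _ _ w).
by rewrite -!catA -uwv -!catA wv.
Qed.

Lemma size_wpow v n : size (wpow v n) = n * size v.
Proof. by elim: n => //= n IHn; rewrite size_cat IHn mulSn. Qed.

(** Both [u] and, once it is long enough, a power of [v] are prefixes of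
    [u v ^ n = v ^ n u]. *)
Lemma commutes_prefix u v : v <> [::] -> commutes u v ->
  u = take (size u) (wpow v (size u)).
Proof.
move=> v0 uv; set n := size u.
have := commutes_wpow n (commutes_sym uv); rewrite /commutes => E.
have sv : 0 < size v by case: (v) v0.
have le_n : n <= size (wpow v n) by rewrite size_wpow leq_pmulr.
by rewrite -(takel_cat u le_n) E take_size_cat.
Qed.

(** * Languages: factorial, recurrent and minimal ones *)

Implicit Types K L : set (seq T).

Definition factorial L : Prop := forall u w, infix u w -> L w -> L u.

Definition infinite_lang L : Prop :=
  factorial L /\ forall n, exists2 w, L w & size w = n.

Definition minimal_lang K : Prop :=
  infinite_lang K /\
  forall K', infinite_lang K' -> K' `<=` K -> K' = K.

Definition recurrent L : Prop :=
  forall u v, L u -> L v -> exists x, L (u ++ x ++ v).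

Lemma factorial_catl L u v : factorial L -> L (u ++ v) -> L u.
Proof. by move=> fL; apply: fL; apply: prefix_infix. Qed.

Lemma factorial_catr L u v : factorial L -> L (u ++ v) -> L v.
Proof. by move=> fL; apply: fL; apply: suffix_infix. Qed.

Lemma factorial_mid L u v w : factorial L -> L (u ++ v ++ w) -> L v.
Proof. by move=> fL; apply: fL; apply: infix_infix. Qed.

Lemma factorial_take L n w : factorial L -> L w -> L (take n w).
Proof. by move=> fL; apply: fL; apply: infix_take. Qed.

Lemma factorial_drop L n w : factorial L -> L w -> L (drop n w).
Proof. by move=> fL; apply: fL; apply: infix_drop. Qed.

Lemma infinite_langI L : factorial L ->
  (forall n, exists2 w, L w & n <= size w) -> infinite_lang L.
Proof.
move=> fL unb; split=> // n; have [w Lw le_n] := unb n.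
by exists (take n w); [exact: factorial_take | rewrite size_takel].
Qed.

Lemma finite_langP L : factorial L -> ~ infinite_lang L ->
  exists N, forall w, L w -> size w < N.
Proof.
move=> fL nL; apply: contrapT => /forallNP H; apply: nL; apply: infinite_langI => // n.
have /existsNP[w /not_implyP[Lw /negP]] := H n.
by rewrite -leqNgt => le_n; exists w.
Qed.

Lemma infinite_lang_nil L : infinite_lang L -> L [::].
Proof. by case=> fL /(_ 0)[[|//] ]. Qed.

(** Compactness: there are finitely many words of each length, so if every
    member of a chain of languages has a word of length [n], so does their
    intersection; hence Zorn's lemma applies. *)
Lemma minimal_lang_below L : infinite_lang L ->
  exists2 K, minimal_lang K & K `<=` L.
Proof.
move=> iL.
pose S := {K : set (seq T) | infinite_lang K /\ K `<=` L}.
pose R (K K' : S) : Prop := sval K' `<=` sval K.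
have [||||K maxK] := @Zorn S (fun a b => `[< R a b >]).
- by move=> K; apply/asboolP.
- move=> K1 K2 K3 /asboolP R12 /asboolP R23; apply/asboolP.
  exact: subset_trans R12.
- move=> [K1 P1] [K2 P2] /asboolP R12 /asboolP R21.
  by apply: eq_exist; apply/seteqP.
- move=> C totC; have [K0|C0] := pselect (exists K : S, C K); last first.
    by exists (exist _ L (conj iL (@subset_refl _ L))) => K CK; case: C0; exists K.
  case: K0 => K0 CK0.
  pose M : set (seq T) := [set w | forall K : S, C K -> sval K w].
  have fM : factorial M.
    by move=> u w uw Mw K CK; case: (svalP K) => [[fK _] _]; apply: (fK _ w) => //; apply: Mw.
  have iM : infinite_lang M.
    split=> // n; apply: contrapT => noM.
    have avoid (ws : seq (n.-tuple T)) :
        exists2 K : S, C K & forall t, t \in ws -> ~ sval K t.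
      elim: ws => [|t ws [K CK avK]]; first by exists K0.
      have [K' CK' nK't] : exists2 K' : S, C K' & ~ sval K' t.
        apply: contrapT => H; apply: noM; exists t; last exact: size_tuple.
        by move=> K' CK'; apply: contrapT => nt; apply: H; exists K'.
      have [/asboolP sub|/asboolP sub] := totC K K' CK CK'.
        exists K' => // s; rewrite inE => /predU1P[->//|/avK nKs /sub].
        exact: nKs.
      by exists K => // s; rewrite inE => /predU1P[-> /sub//|/avK].
    have [K CK avK] := avoid (enum {: n.-tuple T}).
    have [[_ /(_ n)[w Kw /eqP sw]] _] := svalP K.
    by apply: (avK (Tuple sw)) => //; rewrite mem_enum.
  have ML : M `<=` L by move=> w Mw; case: (svalP K0) => _; apply; apply: Mw.
  exists (exist _ M (conj iM ML)) => K CK; apply/asboolP => w; exact.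
- case: K maxK => K [iK KL] maxK; exists K => //; split=> // K' iK' K'K.
  have K'L := subset_trans K'K KL.
  have := maxK (exist _ K' (conj iK' K'L)).
  by move=> /(_ (asboolT K'K)) /(congr1 sval).
Qed.

(** The words of [K] avoiding [w] form a smaller language, so there are finitely
    many of them: minimality is uniform recurrence. *)
Lemma minimal_lang_uniform K w : minimal_lang K -> K w ->
  exists N, forall v, K v -> N <= size v -> infix w v.
Proof.
move=> [[fK infK] minK] Kw.
pose K' := [set v | K v /\ ~~ infix w v].
have fK' : factorial K'.
  move=> u v uv [Kv nwv]; split; first exact: fK uv Kv.
  by apply: contra nwv => wu; apply: infix_trans wu uv.
have niK' : ~ infinite_lang K'.
  move=> iK'; have /minK E := iK'; have : K' w by rewrite E // => v [].
  by case; rewrite infix_refl.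
have [N HN] := finite_langP fK' niK'; exists N => v Kv.
by rewrite leqNgt => /negP lt; apply: contrapT => /negP nwv; apply: lt; apply: HN.
Qed.

Lemma minimal_lang_recurrent K : minimal_lang K -> recurrent K.
Proof.
move=> mK u v Ku Kv; have [[fK infK] _] := mK.
have [Nu Hu] := minimal_lang_uniform mK Ku.
have [Nv Hv] := minimal_lang_uniform mK Kv.
have [w Kw sw] := infK (Nu + Nv).
have /infixP[p1 [q1 E1]] : infix u (take Nu w).
  by apply: Hu; [exact: factorial_take | rewrite size_takel // sw leq_addr].
have /infixP[p2 [q2 E2]] : infix v (drop Nu w).
  by apply: Hv; [exact: factorial_drop | rewrite size_drop sw addKn].
exists (q1 ++ p2); have := Kw; rewrite -(cat_take_drop Nu w) E1 E2.
rewrite -!catA => /(factorial_catr fK); rewrite !catA.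
exact: factorial_catl.
Qed.

Lemma recurrent_infinite L : factorial L -> recurrent L ->
  (exists2 w, L w & w <> [::]) -> infinite_lang L.
Proof.
move=> fL rL [w Lw w0]; apply: infinite_langI => //.
elim=> [|n [v Lv le_n]]; first by exists w.
have [x Lx] := rL _ _ Lw Lv; exists (w ++ x ++ v) => //.
rewrite !size_cat; case: (w) w0 => //= *; lia.
Qed.

Lemma recurrent_extend_left L u : infinite_lang L -> recurrent L -> L u ->
  exists a, L (a :: u).
Proof.
move=> [fL infL] rL Lu; have [v Lv sv] := infL 1.
have [x] := rL _ _ Lv Lu; rewrite catA.
have : size (v ++ x) > 0 by rewrite size_cat sv.
case/lastP: (v ++ x) => [//|y a] _; rewrite cat_rcons => /(factorial_catr fL).
by exists a.
Qed.

Lemma recurrent_extend_right L u n : infinite_lang L -> recurrent L -> L u ->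
  exists2 x, L (u ++ x) & size x = n.
Proof.
move=> [fL infL] rL Lu; have [v Lv sv] := infL n.
have [x Lx] := rL _ _ Lu Lv; exists (take n (x ++ v)).
  by apply: fL Lx; rewrite -[x ++ v in X in infix _ X](cat_take_drop n) catA prefix_infix.
by rewrite size_takel // size_cat sv leq_addl.
Qed.

(** Once a period [n] is fixed a word is determined by its first [n] letters, so
    a recurrent language with a period cannot be shrunk. *)
Lemma periodic_recurrent_minimal L n : 0 < n -> infinite_lang L -> recurrent L ->
  (forall w, L w -> period n w) -> minimal_lang L.
Proof.
move=> n_gt0 iL rL perL; have [K mK KL] := minimal_lang_below iL.
suff -> : L = K by [].
have [[fK infK] _] := mK; have [fL _] := iL.
apply/seteqP; split=> // w Lw; have [v Kv sv] := infK n.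
have [x Lx] := rL _ _ (KL _ Kv) Lw.
have [y Ky sy] := recurrent_extend_right (size (x ++ w)) mK.1 (minimal_lang_recurrent mK) Kv.
have E : v ++ x ++ w = v ++ y.
  apply: (@period_eq n) => //; [exact: perL| by apply: perL; apply: KL | |].
    by rewrite !size_cat -size_cat sy.
  by rewrite -sv !take_size_cat.
by move: Ky; rewrite -E catA => /(factorial_catr fK).
Qed.

End Words.

(** * Counting words *)

Section Counting.
Variable T : finType.
Implicit Types (u v w : seq T) (n : nat) (K L : set (seq T)).

Definition words_of_length L n : seq (seq T) :=
  [seq w <- [seq tval t | t <- enum {: n.-tuple T}] | w \in L].

Definition words_upto L n : seq (seq T) :=
  flatten [seq words_of_length L l | l <- iota 0 n.+1].

Definition quadratic_bound L C : Prop :=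
  forall n, 0 < n -> size (words_upto L n) <= C * n ^ 2.

Lemma mem_words_of_length L n w :
  (w \in words_of_length L n) = (w \in L) && (size w == n).
Proof.
rewrite mem_filter; congr andb; apply/mapP/eqP => [[t _ ->]|sw].
  exact: size_tuple.
by exists (Tuple (introT eqP sw)); rewrite ?mem_enum.
Qed.

Lemma mem_words_upto L n w :
  (w \in words_upto L n) = (w \in L) && (size w <= n).
Proof.
apply/flatten_mapP/andP => [[l]|[Lw le_n]].
  rewrite mem_iota mem_words_of_length => /andP[_ lt_l] /andP[-> /eqP->].
  by split.
by exists (size w); rewrite ?mem_iota // mem_words_of_length Lw eqxx.
Qed.

Lemma uniq_words_of_length L n : uniq (words_of_length L n).
Proof. by rewrite filter_uniq // map_inj_uniq ?enum_uniq //; apply: val_inj. Qed.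

Lemma uniq_words_upto L n : uniq (words_upto L n).
Proof.
rewrite /words_upto; elim: n.+1 => {n}[|n IHn] //.
rewrite -addn1 iotaD map_cat flatten_cat cat_uniq IHn /= add0n cats0.
rewrite uniq_words_of_length andbT /=; apply/hasPn => w.
rewrite mem_words_of_length => /andP[_ /eqP sw].
apply/flatten_mapP => -[l]; rewrite mem_iota add0n mem_words_of_length sw.
by move=> /andP[_ lt_l] /andP[_ /eqP E]; rewrite -E ltnn in lt_l.
Qed.

Lemma size_words_upto L n :
  size (words_upto L n) = \sum_(l < n.+1) size (words_of_length L l).
Proof.
by rewrite size_flatten /shape -map_comp sumnE big_map -[iota 0 _]/(index_iota 0 n.+1) big_mkord.
Qed.

Lemma mul_square_lt_exp2 D : exists2 m, 0 < m & D * m ^ 2 < 2 ^ m.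
Proof.
(* With [m = 4 * j] and [16 * D < j] one has
   [D * m ^ 2 <= j ^ 3 < (2 ^ j) ^ 4 = 2 ^ m]. *)
pose j := 16 * D + 1; exists (4 * j); first by rewrite /j; lia.
have j2 : j < 2 ^ j by apply: ltn_expl.
have -> : 2 ^ (4 * j) = (2 ^ j) ^ 4 by rewrite mulnC expnM.
have le1 : D * (4 * j) ^ 2 <= j ^ 3.
  rewrite expnMn (expnS j 2) mulnA leq_mul2r /j; apply/orP; right; lia.
apply: leq_ltn_trans le1 _; apply: (@leq_ltn_trans ((2 ^ j) ^ 3)).
  by rewrite leq_exp2r // ltnW.
by rewrite ltn_exp2l // (leq_ltn_trans _ j2) // /j; lia.
Qed.

Definition fill p q (s : seq (seq T)) (bs : seq bool) : seq T :=
  flatten [seq ab.1 ++ (if ab.2 then p else q) | ab <- zip s bs].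

Lemma size_fill p q s bs : size p = size q -> size s = size bs ->
  size (fill p q s bs) = size (flatten s) + size s * size p.
Proof.
move=> Epq; elim: s bs => [|a s IHs] [|b bs] //= [Es].
have Eb : size (if b then p else q) = size p by case: b.
by rewrite /fill /= !size_cat Eb (IHs bs) // mulSn addnACA.
Qed.

Lemma fill_inj p q s bs bs' : p <> q -> size p = size q ->
  size s = size bs -> size s = size bs' ->
  fill p q s bs = fill p q s bs' -> bs = bs'.
Proof.
move=> npq Epq; elim: s bs bs' => [|a s IHs] [|b bs] [|b' bs'] //= [Es] [Es'].
rewrite /fill /= -!catA => /cat_injr /eqP; rewrite eqseq_cat; last by case: b b' => [] [].
case/andP=> /eqP Eb /eqP /IHs-> //; congr (_ :: _).
by case: b b' Eb => [] [] // E; case: npq.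
Qed.

(** Two distinct words of the same length that may be exchanged freely at [m]
    places, in words of length linear in [m], produce [2 ^ m] words: too many for
    a quadratic bound. *)
Lemma no_free_exchange L C p q N : quadratic_bound L C -> p <> q ->
  size p = size q ->
  (forall m, exists s, [/\ size s = m, size (flatten s) <= N * m &
     forall bs, size bs = m -> L (fill p q s bs)]) -> False.
Proof.
move=> quadL npq Epq H.
have [m m_gt0] := mul_square_lt_exp2 (C * (N + size p) ^ 2).
have [s [sm sN Ls]] := H m.
have sp : 0 < size p.
  by case: (p) (q) npq Epq => [|? ?] [|? ?].
pose ws := [seq fill p q s (tval t) | t <- enum {: m.-tuple bool}].
have uws : uniq ws.
  rewrite map_inj_in_uniq ?enum_uniq // => t t' _ _ E; apply: val_inj.
  by apply: (fill_inj npq Epq _ _ E); rewrite size_tuple.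
have sub : {subset ws <= words_upto L ((N + size p) * m)}.
  move=> _ /mapP[t _ ->]; rewrite mem_words_upto mem_set; last first.
    by apply: Ls; rewrite size_tuple.
  by rewrite size_fill ?size_tuple // sm /=; lia.
have := uniq_leq_size uws sub.
rewrite size_map -cardE card_tuple card_bool => le1.
have := leq_trans le1 (quadL _ _).
rewrite muln_gt0 addn_gt0 sp orbT m_gt0 => /(_ isT).
by rewrite expnMn mulnA leqNgt => /negP nlt lt; apply: nlt.
Qed.

(** * Finitely many minimal languages *)

Definition left_special L v : Prop :=
  exists a b, [/\ a <> b, L (a :: v) & L (b :: v)].

(** If no word of length [n] of [K] were left special in [L], reading a word of
    [L] from right to left would never leave [K]. *)
Lemma exists_left_special L K : infinite_lang L -> recurrent L ->
  minimal_lang K -> K `<=` L -> K <> L ->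
  exists n0, forall n, n0 <= n ->
    exists v, [/\ K v, size v = n & left_special L v].
Proof.
move=> iL rL mK KL nKL; have [fL infL] := iL.
have rK := minimal_lang_recurrent mK; have [[fK infK] _] := mK.
have [w Lw nKw] : exists2 w, L w & ~ K w.
  apply: contrapT => H; apply: nKL; apply/seteqP; split=> // w Lw.
  by apply: contrapT => nKw; apply: H; exists w.
exists (size w) => n le_n; apply: contrapT => nospec.
have [v Kv sv] := infK n.
have stay y : L (y ++ v) -> K (take n (y ++ v)).
  elim: y => [|a y IHy] /=; first by rewrite -sv take_size.
  move=> Layv; have Lyv := factorial_catr (u := [:: a]) fL Layv.
  have Kt := IHy Lyv.
  have [b Kb] := recurrent_extend_left mK.1 rK Kt.
  have Eab : a = b.
    apply: contrapT => nab; apply: nospec; exists (take n (y ++ v)); split=> //.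
      by rewrite size_takel // size_cat sv leq_addl.
    exists a, b; split=> //; last exact: KL.
    by have := factorial_take n.+1 fL Layv.
  rewrite Eab; case: (n) Kb => [|n'] Kb; first by apply: (factorial_catl (v := b :: take 0 (y++v)) fK).
  have -> : take n'.+1 (b :: y ++ v) = take n'.+1 (b :: take n'.+1 (y ++ v)).
    by rewrite /= take_takel.
  exact: factorial_take.
have [x Lwx sx] := recurrent_extend_right n iL rL Lw.
have [z Lwz] := rL _ _ Lwx (KL _ Kv).
apply: nKw; have := stay ((w ++ x) ++ z); rewrite -!catA in Lwz * => /(_ Lwz).
by move/(factorial_take (size w) fK); rewrite take_takel // take_size_cat.
Qed.

Lemma minimal_lang_disjoint K K' : minimal_lang K -> minimal_lang K' ->
  K <> K' -> exists n0, forall v, K v -> K' v -> size v < n0.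
Proof.
move=> [iK mK] [iK' mK'] nKK'.
have fI : factorial (K `&` K').
  by move=> u w uw [Kw K'w]; split; [exact: iK.1 uw Kw | exact: iK'.1 uw K'w].
have nI : ~ infinite_lang (K `&` K').
  move=> iI; apply: nKK'; rewrite -(mK _ iI (@subIsetl _ _ _)).
  exact: mK' iI (@subIsetr _ _ _).
by have [n0 H] := finite_langP fI nI; exists n0 => v Kv K'v; apply: H.
Qed.

(** Distinct minimal languages share no long words, hence their left special words
    of a large length [n] are distinct. *)
Lemma left_special_family L (Ks : seq (set (seq T))) :
  infinite_lang L -> recurrent L -> uniq Ks ->
  (forall K, K \in Ks -> [/\ minimal_lang K, K `<=` L & K <> L]) ->
  exists n0, forall n, n0 <= n -> exists s : seq (seq T),
    [/\ uniq s, size s = size Ks & forall v, v \in s ->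
        [/\ size v = n, L v, left_special L v & exists2 K, K \in Ks & K v]].
Proof.
move=> iL rL; elim: Ks => [|K Ks IHKs] /=; first by exists 0 => n _; exists [::].
case/andP=> nKKs uKs HKs.
have [n1 H1] := IHKs uKs (fun K' K'Ks => HKs K' (mem_behead (s := K :: Ks) K'Ks)).
have [mK KL nKL] := HKs K (mem_head _ _).
have [n2 H2] := exists_left_special iL rL mK KL nKL.
have [n3 H3] : exists n3, forall K', K' \in Ks -> forall v, K v -> K' v -> size v < n3.
  elim: Ks nKKs HKs {IHKs H1 uKs} => [|K' Ks IHKs]; first by exists 0.
  rewrite inE negb_or => /andP[nKK' nKKs] HKs.
  have [|n3 H3] := IHKs nKKs.
    move=> K1; rewrite inE => /predU1P[->|K1s]; apply: HKs; first exact: mem_head.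
    by rewrite !inE K1s !orbT.
  have [mK' _ _] : [/\ minimal_lang K', K' `<=` L & K' <> L].
    by apply: HKs; rewrite !inE eqxx orbT.
  have [n4 H4] := minimal_lang_disjoint mK mK' (elimN eqP nKK').
  exists (n3 + n4) => K1; rewrite inE => /predU1P[->|K1s] v Kv K'v.
    by apply: ltn_addl; apply: H4.
  by apply: ltn_addr; apply: H3 K'v.
exists (n1 + n2 + n3) => n le_n.
have [s [us ss Hs]] := H1 n ltac:(lia).
have [v [Kv sv spv]] := H2 n ltac:(lia).
exists (v :: s); split.
- rewrite /= us andbT; apply/negP => /Hs[_ _ _ [K' K'Ks K'v]].
  by have := H3 _ K'Ks _ Kv K'v; lia.
- by rewrite /= ss.
- move=> u; rewrite inE => /predU1P[->|/Hs[su Lu spu [K' K'Ks K'u]]].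
    by split=> //; [exact: KL | exists K => //; exact: mem_head].
  by split=> //; exists K' => //; rewrite inE K'Ks orbT.
Qed.

(** Every word of length [n] has an extension to the left, and a left special one
    has a second extension. *)
Lemma words_of_length_step L (s : seq (seq T)) n :
  infinite_lang L -> recurrent L -> uniq s ->
  (forall v, v \in s -> [/\ size v = n, L v & left_special L v]) ->
  size (words_of_length L n) + size s <= size (words_of_length L n.+1).
Proof.
move=> iL rL us Hs.
have /choice[e1 He1] : forall v, exists w, L v ->
    [/\ L w, behead w = v & size w = (size v).+1].
  move=> v; have [Lv|nLv] := pselect (L v); last by exists [::].
  by have [a La] := recurrent_extend_left iL rL Lv; exists (a :: v).
have /choice[e2 He2] : forall v, exists w, left_special L v ->
    [/\ L w, behead w = v, size w = (size v).+1 & w <> e1 v].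
  move=> v; have [spv|nsp] := pselect (left_special L v); last by exists [::].
  have [a [b [nab La Lb]]] := spv.
  have [E|nE] := eqVneq (a :: v) (e1 v); last by exists (a :: v) => _; split=> //; exact/eqP.
  by exists (b :: v) => _; split=> //; rewrite -E => -[/esym].
have inj1 : {in words_of_length L n &, injective e1}.
  move=> u v; rewrite !mem_words_of_length => /andP[/set_mem Lu _] /andP[/set_mem Lv _] E.
  by have [_ <- _] := He1 _ Lu; have [_ <- _] := He1 _ Lv; rewrite E.
have inj2 : {in s &, injective e2}.
  move=> u v /Hs[_ _ spu] /Hs[_ _ spv] E.
  by have [_ <- _ _] := He2 _ spu; have [_ <- _ _] := He2 _ spv; rewrite E.
rewrite -(size_map e1) -(size_map e2 s) -size_cat; apply: uniq_leq_size.
  rewrite cat_uniq !map_inj_in_uniq // uniq_words_of_length us andbT /=.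
  apply/hasPn => _ /mapP[v /Hs[sv Lv spv] ->].
  apply/mapP => -[u]; rewrite mem_words_of_length => /andP[/set_mem Lu _] E.
  have [_ Ev _ nE] := He2 _ spv; have [_ Eu _] := He1 _ Lu.
  by apply: nE; rewrite E; congr e1; rewrite -Eu -E Ev.
move=> w; rewrite mem_cat => /orP[] /mapP[v].
  rewrite !mem_words_of_length => /andP[/set_mem Lv /eqP sv] ->.
  by have [/mem_set-> _ ->] := He1 _ Lv; rewrite sv eqxx.
move=> /Hs[sv Lv spv] ->; rewrite mem_words_of_length.
by have [/mem_set-> _ -> _] := He2 _ spv; rewrite sv eqxx.
Qed.

Lemma minimal_family_bound L C (Ks : seq (set (seq T))) :
  quadratic_bound L C -> infinite_lang L -> recurrent L -> uniq Ks ->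
  (forall K, K \in Ks -> [/\ minimal_lang K, K `<=` L & K <> L]) ->
  size Ks <= 9 * C.
Proof.
move=> quadL iL rL uKs HKs; set m := size Ks.
have [n0 Hn0] := left_special_family iL rL uKs HKs.
have step n : n0 <= n -> size (words_of_length L n) + m <= size (words_of_length L n.+1).
  move=> /Hn0[s [us ss Hs]]; rewrite /m -ss.
  by apply: words_of_length_step => // v /Hs[].
have lower i : m * i <= size (words_of_length L (n0 + i)).
  elim: i => [|i IHi]; first by rewrite muln0.
  by rewrite addnS mulnS addnC (leq_trans _ (step _ (leq_addr _ _))) // leq_add2r.
(* With [n0 < j], the lengths from [n0 + j] to [n0 + 2 * j] already account for
   [m * j ^ 2] words, while [C * (n0 + 2 * j) ^ 2 <= C * (3 * j) ^ 2]. *)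
pose j := n0.+1.
have := quadL (n0 + 2 * j) ltac:(lia); rewrite size_words_upto.
have -> : (n0 + 2 * j).+1 = (n0 + j) + j.+1 by lia.
rewrite big_split_ord /= => le1.
have le2 : j.+1 * (m * j) <=
    \sum_(i < j.+1) size (words_of_length L (rshift (n0 + j) i)).
  rewrite -[X in X * _ <= _]card_ord -sum_nat_const; apply: leq_sum => i _ /=.
  by rewrite -addnA (leq_trans _ (lower _)) // leq_mul2l leq_addr orbT.
have le3 : m * j ^ 2 <= 9 * C * j ^ 2.
  have -> : 9 * C * j ^ 2 = C * (3 * j) ^ 2 by rewrite expnMn; lia.
  apply: (@leq_trans (C * (n0 + 2 * j) ^ 2)); last first.
    by rewrite leq_mul2l leq_sqr; apply/orP; right; lia.
  by apply: leq_trans le1; rewrite (leq_trans _ (leq_addl _ _)) // (leq_trans _ le2) //; lia.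
by rewrite leq_pmul2r ?expn_gt0 // in le3.
Qed.

(** A minimal [L] contains no other minimal language; otherwise all of them are
    proper and [minimal_family_bound] applies. *)
Lemma finitely_many_minimal L C :
  quadratic_bound L C -> infinite_lang L -> recurrent L ->
  exists Ks : seq (set (seq T)),
    forall K, minimal_lang K -> K `<=` L -> K \in Ks.
Proof.
move=> quadL iL rL; have [mL|nmL] := pselect (minimal_lang L).
  by exists [:: L] => K [iK _] KL; rewrite inE; apply/eqP; exact: mL.2.
pose P m := `[< exists Ks : seq (set (seq T)), [/\ uniq Ks, size Ks = m &
  forall K, K \in Ks -> minimal_lang K /\ K `<=` L] >].
have P0 : exists m, P m by exists 0; apply/asboolP; exists [::].
have leP m : P m -> m <= 9 * C.
  move=> /asboolP[Ks [uKs <- HKs]]; apply: (minimal_family_bound quadL iL rL uKs).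
  by move=> K /HKs[mK KL]; split=> // E; apply: nmL; rewrite -E.
case: (ex_maxnP P0 leP) => m /asboolP[Ks [uKs sm HKs]] maxm; exists Ks => K mK KL.
apply: contrapT => /negP nK; have := maxm m.+1; rewrite ltnn => H.
suff /H : P m.+1 by [].
apply/asboolP; exists (K :: Ks); split; rewrite /= ?nK ?sm // => K'.
by rewrite inE => /predU1P[->|/HKs].
Qed.

Lemma words_of_length_periodic L n l : 0 < n -> (forall w, L w -> period n w) ->
  size (words_of_length L l) <= #|{ffun 'I_n -> option T}|.
Proof.
move=> n_gt0 perL.
pose f w : {ffun 'I_n -> option T} := [ffun i : 'I_n => onth w i].
rewrite -(size_map f) -(card_uniqP _) ?max_card //.
rewrite map_inj_in_uniq ?uniq_words_of_length // => u v.
rewrite !mem_words_of_length => /andP[/set_mem Lu /eqP su] /andP[/set_mem Lv /eqP sv] E.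
apply: (@period_eq _ n) => //; [exact: perL | exact: perL | by rewrite su | ].
apply: eq_from_onth => i.
have [lt_in|le_ni] := ltnP i n; last first.
  by rewrite !onth_default // size_take; case: ifP; lia.
have := congr1 (fun g : {ffun _} => g (Ordinal lt_in)) E; rewrite !ffunE /=.
by rewrite !onthE !map_take !nth_take.
Qed.

Lemma periodic_linear_growth L n : 0 < n -> (forall w, L w -> period n w) ->
  exists D, forall N, 0 < N -> size (words_upto L N) <= D * N.
Proof.
move=> n_gt0 perL; exists (2 * #|{ffun 'I_n -> option T}|) => N N_gt0.
rewrite size_words_upto (@leq_trans (\sum_(l < N.+1) #|{ffun 'I_n -> option T}|)) //.
  by apply: leq_sum => l _; apply: words_of_length_periodic.
rewrite sum_nat_const card_ord; nia.
Qed.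

End Counting.

(** * Interchangeable words *)

Section Exchange.
Variable T : finType.
Implicit Types (p q u v w x y z : seq T) (n : nat) (K L : set (seq T)).

Lemma quadratic_bound_sub K L C : K `<=` L ->
  quadratic_bound L C -> quadratic_bound K C.
Proof.
move=> KL quadL n n_gt0; apply: leq_trans (quadL n n_gt0).
apply: uniq_leq_size (uniq_words_upto _ _) _ => w; rewrite !mem_words_upto.
by move=> /andP[/set_mem/KL/mem_set-> ->].
Qed.

(** Otherwise [u v] and [v u] are distinct words of the same length, and they may
    be chosen independently in a long product. *)
Lemma free_products_commute L C u v : quadratic_bound L C ->
  (forall us, {subset us <= [:: u; v]} -> L (flatten us)) -> commutes u v.
Proof.
move=> quadL Luv; apply: contrapT => nuv.
apply: (no_free_exchange (N := 0) quadL nuv); first by rewrite !size_cat addnC.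
move=> m; exists (nseq m [::]); rewrite size_nseq; split=> //.
  by elim: m => //= m IHm.
move=> bs sbs; pose us := flatten [seq if b then [:: u; v] else [:: v; u] | b <- bs].
have -> : fill (u ++ v) (v ++ u) (nseq m [::]) bs = flatten us.
  rewrite /us /fill; elim: bs m {us} sbs => [|b bs IHbs] [|m] //= [sbs].
  by rewrite (IHbs _ sbs); case: b; rewrite /= -catA.
apply: Luv => w /flattenP[_ /mapP[b _ ->]].
by case: b; rewrite !inE // orbC.
Qed.

(** Equality of contexts: the syntactic congruence of [K]. *)
Definition congruent K u v : Prop :=
  forall p q, K (p ++ u ++ q) <-> K (p ++ v ++ q).

Lemma congruent_sym K u v : congruent K u v -> congruent K v u.
Proof. by move=> uv p q; split=> /uv. Qed.

Lemma congruent_trans K v u w :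
  congruent K u v -> congruent K v w -> congruent K u w.
Proof. by move=> uv vw p q; split=> [/uv/vw | /vw/uv]. Qed.

Lemma congruent_cat K p q u v : congruent K u v ->
  congruent K (p ++ u ++ q) (p ++ v ++ q).
Proof.
by move=> uv p' q'; have := uv (p' ++ p) (q ++ q'); rewrite !catA.
Qed.

Lemma congruent_mem K u v : congruent K u v -> K u -> K v.
Proof. by move=> /(_ [::] [::]); rewrite /= !cats0 => -[]. Qed.

Lemma congruent_fill K p q s x z bs : congruent K p q -> size s = size bs ->
  K (x ++ fill p q s (nseq (size s) true) ++ z) -> K (x ++ fill p q s bs ++ z).
Proof.
move=> pq; elim: s bs x => [|a s IHs] [|b bs] x //= [sbs].
rewrite /fill /= -/(fill p q _ _) => Kx.
have -> : x ++ ((a ++ (if b then p else q)) ++ fill p q s bs) ++ z =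
    (x ++ a ++ (if b then p else q)) ++ fill p q s bs ++ z by rewrite !catA.
apply: IHs => //; case: b; first by move: Kx; rewrite !catA.
by have := (pq (x ++ a) (fill p q s (nseq (size s) true) ++ z)).1; rewrite !catA in Kx * => /(_ Kx).
Qed.

(** The occurrences of [p] in a uniformly recurrent language have bounded gaps,
    and each of them may be replaced by [q]. *)
Lemma congruent_eq K C p q : minimal_lang K -> quadratic_bound K C ->
  K p -> congruent K p q -> size p = size q -> p = q.
Proof.
move=> mK quadK Kp pq Epq; apply: contrapT => npq.
have [[fK infK] _] := mK.
have [N HN] := minimal_lang_uniform mK Kp.
apply: (no_free_exchange (N := N) quadK npq Epq) => m.
have cut w : K w -> N * m <= size w -> exists s z, [/\ size s = m,
    size (flatten s) <= N * m & w = fill p q s (nseq m true) ++ z].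
  elim: m w => [|m IHm] w Kw le_w; first by exists [::], w; rewrite muln0.
  have le_N : N <= size w by rewrite (leq_trans _ le_w) // mulnS leq_addr.
  have /infixP[a [b E]] : infix p (take N w).
    by apply: HN; [exact: factorial_take | rewrite size_takel].
  have sab : size a + (size p + size b) = N.
    by rewrite -!size_cat -E size_takel.
  have Ew : w = a ++ p ++ (b ++ drop N w) by rewrite -[LHS](cat_take_drop N) E -!catA.
  have [|//|s [z [ss sf E']]] := IHm (b ++ drop N w).
  - by apply: (factorial_catr (u := a ++ p) fK); rewrite -catA -Ew.
  - by move: le_w; rewrite size_cat size_drop mulnS; lia.
  exists (a :: s), z; rewrite /= ss size_cat; split=> //; first by rewrite mulnS leq_add // -sab leq_addr.
  by rewrite {1}Ew E' /fill /= -!catA.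
have [w Kw sw] := infK (N * m).
have [s [z [ss sf Ew]]] := cut w Kw (eq_leq (esym sw)).
exists s; split=> // bs sbs; apply: (factorial_catl (v := z) fK).
by apply: (@congruent_fill _ _ _ _ [::]) => //=; rewrite ss // -Ew.
Qed.

(** [u x v] and [v x u] have the same length, and both are congruent to
    [u x u]. *)
Lemma congruent_commute K C u v x : minimal_lang K -> quadratic_bound K C ->
  congruent K u v -> K (u ++ x ++ u) -> u ++ x ++ v = v ++ x ++ u.
Proof.
move=> mK quadK uv Kuxu.
have E1 : congruent K (u ++ x ++ u) (u ++ x ++ v).
  by have := congruent_cat (u ++ x) [::] uv; rewrite !cats0 -!catA.
have E2 : congruent K (u ++ x ++ u) (v ++ x ++ u).
  by have := congruent_cat [::] (x ++ u) uv.
apply: (congruent_eq mK quadK); first exact: congruent_mem E1 Kuxu.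
  exact: congruent_trans (congruent_sym E1) E2.
by rewrite !size_cat addnCA [RHS]addnC addnA addnC addnA.
Qed.

(** Two different words [a], [b] with the same contexts have different lengths,
    and [a x b = b x a] as soon as [a x a] is in [K].  If [a] is the shorter one,
    [b x = a x t] with [t] commuting with [a x]; the congruence of [a x] and
    [a x t] then puts every power of [t] into [K]. *)
Lemma congruent_family K C (ws : seq (seq T)) a b :
  minimal_lang K -> quadratic_bound K C ->
  (forall w, w \in ws -> K w) ->
  (forall u w, u \in ws -> w \in ws -> congruent K u w) ->
  a \in ws -> b \in ws -> a <> b ->
  exists x v, [/\ v <> [::],
    forall w, w \in ws -> K (w ++ x) /\ commutes (w ++ x) v,
    forall y, commutes y v -> K y & exists2 w, w \in ws & w ++ x <> [::]].
Proof.
move=> mK quadK Kws congr_ws.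
wlog le_ab : a b / size a <= size b.
  move=> H aws bws nab; have [le|/ltnW le] := leqP (size a) (size b).
    exact: (H a b).
  by apply: (H b a) => // E; apply: nab.
move=> aws bws nab; have [[fK _] _] := mK.
have [x Kaxa] := minimal_lang_recurrent mK (Kws _ aws) (Kws _ aws).
have ab := congr_ws _ _ aws bws.
have Kuxw u w : u \in ws -> w \in ws -> K (u ++ x ++ w).
  move=> uws wws.
  have au := congruent_cat [::] (x ++ a) (congr_ws _ _ aws uws).
  have aw := congruent_cat (u ++ x) [::] (congr_ws _ _ aws wws).
  move/(congruent_mem au): Kaxa; rewrite /= catA -[a in K (_ ++ a)]cats0.
  by move/(congruent_mem aw); rewrite cats0 -catA.
have comm u w : u \in ws -> w \in ws -> commutes (u ++ x) (w ++ x).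
  move=> uws wws; have uw := congr_ws _ _ uws wws.
  have := congruent_commute mK quadK uw (Kuxw _ _ uws uws).
  by move/(congr1 (cat^~ x)); rewrite /commutes /= -!catA.
have lt_ab : size a < size b.
  rewrite ltn_neqAle le_ab andbT; apply/eqP => Eab; apply: nab.
  have := comm _ _ aws bws; rewrite /commutes => /eqP.
  by rewrite -!catA eqseq_cat // => /andP[/eqP].
set v1 := a ++ x; set v2 := b ++ x.
have lt_v : size v1 < size v2 by rewrite !size_cat ltn_add2r.
pose t := drop (size v1) v2.
have Ev2 : v2 = v1 ++ t.
  rewrite -[LHS](cat_take_drop (size v1)); congr (_ ++ _).
  by rewrite -(takel_cat v1 (ltnW lt_v)) -(comm _ _ aws bws) take_size_cat.
have t0 : t <> [::] by move=> E; move: lt_v; rewrite Ev2 E cats0 ltnn.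
have ct1 : commutes t v1.
  apply: commutes_sym; apply: (@cat_injr _ v1).
  by have := comm _ _ aws bws; rewrite /commutes -/v1 -/v2 Ev2 -(catA v1 t v1).
have Kv1t n : K (v1 ++ wpow t n).
  elim: n => [|n IHn] /=; first by rewrite cats0; have := Kuxw _ _ aws aws; rewrite catA => /(factorial_catl fK).
  by have /(_ [::] (x ++ wpow t n)) [] := ab; rewrite /= catA -/v1 => /(_ IHn); rewrite catA -/v2 Ev2 -catA.
have Kt n : K (wpow t n) by apply: factorial_catr (Kv1t n).
have v20 : v2 <> [::] by move=> E; move: lt_v; rewrite E ltn0.
have ct2 : commutes v2 t.
  by rewrite Ev2; apply: commutes_cat => //; exact: commutes_sym.
exists x, v2; split=> //; last by exists b.
  move=> w wws; split; last exact: comm.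
  by have := Kuxw _ _ wws wws; rewrite catA => /(factorial_catl fK).
move=> y yv2; rewrite (commutes_prefix v20 yv2); apply: factorial_take => //.
rewrite (commutes_prefix t0 (commutes_wpow _ ct2)); exact: factorial_take.
Qed.

(** The factors of the words commuting with [v] form an infinite language with
    period [size v], which exhausts [K] by minimality. *)
Lemma commutes_sub_periodic K v : minimal_lang K -> v <> [::] ->
  (forall y, commutes y v -> K y) -> forall w, K w -> period (size v) w.
Proof.
move=> [[fK _] minK] v0 Kv.
pose F : set (seq T) := [set w | exists2 y, commutes y v & infix w y].
have fF : factorial F.
  by move=> u w uw [y yv wy]; exists y => //; apply: infix_trans wy.
have iF : infinite_lang F.
  apply: infinite_langI => // n; exists (wpow v n).
    by exists (wpow v n); [exact: commutes_wpow | exact: infix_refl].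
  by rewrite size_wpow leq_pmulr //; case: (v) v0.
have FK : F `<=` K by move=> w [y /Kv Ky wy]; apply: fK wy Ky.
move=> w; rewrite -(minK _ iF FK) => -[y yv wy].
exact: period_infix wy (commutes_period yv).
Qed.

End Exchange.

Local Open Scope ring_scope.

(** * Ideals, the Jacobson radical and primitivity *)

Section RingTheory.
Variable R : nzRingType.
Implicit Types (I J M : set R) (a b r x y : R).

Lemma submoduleP (S : nzRingType) (V : lmodType S) (U : set V) :
  submodule U <-> U 0 /\ forall (c : S) (u v : V), U u -> U v -> U (c *: u + v).
Proof.
split=> [[/set_mem U0 Ul]|[U0 Ul]].
  by split=> // a x y /mem_set Ux /mem_set Uy; apply/set_mem/Ul.
by split=> [|a x y /set_mem Ux /set_mem Uy]; apply/mem_set => //; apply: Ul.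
Qed.

Lemma left_idealP I :
  left_ideal I <-> I 0 /\ forall a x y, I x -> I y -> I (a * x + y).
Proof. exact: (@submoduleP R R^o I). Qed.

Lemma left_idealD I x y : left_ideal I -> I x -> I y -> I (x + y).
Proof. by move=> /left_idealP[_ Il] Ix Iy; rewrite -[x]mul1r; apply: Il. Qed.

Lemma left_idealMl I a x : left_ideal I -> I x -> I (a * x).
Proof. by move=> /left_idealP[I0 Il] Ix; rewrite -[a * x]addr0; apply: Il. Qed.

Lemma left_idealB I x y : left_ideal I -> I x -> I y -> I (x - y).
Proof.
by move=> lI Ix Iy; apply: left_idealD => //; rewrite -mulN1r; apply: left_idealMl.
Qed.

Lemma left_ideal_one I : left_ideal I -> I 1 -> I = setT.
Proof.
move=> lI I1; apply/seteqP; split=> // x _; rewrite -[x]mulr1.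
exact: left_idealMl.
Qed.

Lemma principal_left_ideal x : left_ideal [set a * x | a in setT].
Proof.
apply/left_idealP; split; first by exists 0; rewrite ?mul0r.
by move=> c _ _ [a _ <-] [b _ <-]; exists (c * a + b); rewrite // mulrDl mulrA.
Qed.

Lemma left_ideal_sum I x : left_ideal I ->
  left_ideal [set m + a * x | m in I & a in setT].
Proof.
move=> lI; apply/left_idealP; split.
  by exists 0; [by case/left_idealP: lI | exists 0 => //; rewrite mul0r addr0].
move=> c _ _ [m Im [a _ <-]] [m' Im' [a' _ <-]].
exists (c * m + m'); first by apply: left_idealD => //; apply: left_idealMl.
by exists (c * a + a'); rewrite // mulrDr mulrDl !mulrA addrACA.
Qed.

Lemma maximal_left_ideal_above I : left_ideal I -> ~ I 1 ->
  exists2 M, maximal_left_ideal M & I `<=` M.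
Proof.
move=> lI nI1.
pose S := {J : set R | [/\ left_ideal J, ~ J 1 & I `<=` J]}.
have [||||M maxM] := @Zorn S (fun P Q : S => `[< sval P `<=` sval Q >]).
- by move=> J; apply/asboolP.
- by move=> J1 J2 J3 /asboolP R12 /asboolP R23; apply/asboolP; exact: subset_trans R23.
- move=> [J1 P1] [J2 P2] /asboolP R12 /asboolP R21.
  by apply: eq_exist; apply/seteqP.
- move=> C totC; have [[J0 CJ0]|C0] := pselect (exists J : S, C J); last first.
    by exists (exist _ I (And3 lI nI1 (@subset_refl _ I))) => K CK; case: C0; exists K.
  pose U : set R := [set x | exists2 J : S, C J & sval J x].
  have lU : left_ideal U.
    apply/left_idealP; split.
      by exists J0 => //; have [/left_idealP[]] := svalP J0.
    move=> a x y [J1 CJ1 J1x] [J2 CJ2 J2y].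
    have [/asboolP sub|/asboolP sub] := totC _ _ CJ1 CJ2.
      by exists J2 => //; have [/left_idealP[_ H] _ _] := svalP J2; apply: H => //; apply: sub.
    by exists J1 => //; have [/left_idealP[_ H] _ _] := svalP J1; apply: H => //; apply: sub.
  have nU1 : ~ U 1 by move=> [J _]; have [] := svalP J.
  have IU : I `<=` U.
    by move=> x Ix; exists J0 => //; have [_ _] := svalP J0; apply.
  by exists (exist _ U (And3 lU nU1 IU)) => J CJ; apply/asboolP => x Jx; exists J.
case: M maxM => M [lM nM1 IM] maxM; exists M => //; split=> //.
  by move=> E; have := nM1; rewrite {1}E; apply.
move=> J lJ MJ; have [J1|nJ1] := pselect (J 1); [right|left].
  exact: left_ideal_one.
have := maxM (exist _ J (And3 lJ nJ1 (subset_trans IM MJ))).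
by move=> /(_ (asboolT MJ)) /(congr1 sval).
Qed.

Lemma maximal_left_ideal_one M : maximal_left_ideal M -> ~ M 1.
Proof. by case=> lM nM _ /(left_ideal_one lM). Qed.

Lemma maximal_left_ideal_comax M x y : maximal_left_ideal M -> ~ M x ->
  exists2 m, M m & exists a, y = m + a * x.
Proof.
move=> [lM nM maxM] nMx; have lS := left_ideal_sum x lM.
have MS : M `<=` [set m + a * x | m in M & a in setT].
  by move=> m Mm; exists m => //; exists 0 => //; rewrite mul0r addr0.
have [E|E] := maxM _ lS MS.
  case: nMx; rewrite -E; exists 0; first by case/left_idealP: lM.
  by exists 1; rewrite // mul1r add0r.
have [m Mm [a _ <-]] : [set m + a * x | m in M & a in setT] y by rewrite E.
by exists m => //; exists a.
Qed.

(** For a maximal left ideal [M] and [r] outside it, [M : r] is again a maximal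
    left ideal: this is what makes the intersection of all of them stable under
    right multiplication. *)
Lemma jacobson_radical_ideal : two_sided_ideal (jacobson_radical R).
Proof.
split.
  apply/left_idealP; split; first by move=> M [/left_idealP[]].
  move=> a x y Jx Jy M maxM; have [/left_idealP[_ H] _ _] := maxM.
  by apply: H; [apply: Jx | apply: Jy].
move=> x r Jx M maxM; have [lM nM _] := maxM.
have [Mr|nMr] := pselect (M r); first exact: left_idealMl.
have lC : left_ideal [set a | M (a * r)].
  apply/left_idealP; split=> /=; first by rewrite mul0r; case/left_idealP: lM.
  move=> a b c Mb Mc; rewrite mulrDl -mulrA; apply: left_idealD => //.
  exact: left_idealMl.
apply: (Jx [set a | M (a * r)]); split=> //.
  by move=> /seteqP[_ /(_ 1 I)] /=; rewrite mul1r.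
move=> J lJ CJ; have [JC|nJC] := pselect (J `<=` [set a | M (a * r)]).
  by left; apply/seteqP.
right; have [a Ja nMar] : exists2 a, J a & ~ M (a * r).
  by apply: contrapT => H; apply: nJC => a Ja /=; apply: contrapT => nM'; apply: H; exists a.
have [m Mm [b E]] := maximal_left_ideal_comax r maxM nMar.
apply: left_ideal_one => //; rewrite -(subrK (b * a) 1).
apply: left_idealD => //; last exact: left_idealMl.
by apply: CJ => /=; rewrite mulrBl mul1r -mulrA {1}E addrK.
Qed.

Lemma jacobson_radical_left_inverse g : jacobson_radical R g ->
  exists b, b * (1 - g) = 1.
Proof.
move=> Jg; apply: contrapT => H.
have [|M maxM IM] := maximal_left_ideal_above (principal_left_ideal (1 - g)).
  by move=> [b _ E]; apply: H; exists b.
apply: (maximal_left_ideal_one maxM); have [lM _ _] := maxM.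
rewrite -(subrK g 1); apply: left_idealD => //; last exact: Jg.
by apply: IM; exists 1; rewrite // mul1r.
Qed.

(** If [1 = m + a x] with [m] in a maximal left ideal, the geometric sum of the
    nilpotent element [a x] is a left inverse of [m]. *)
Lemma nil_left_ideal_jacobson x : (forall a, exists n, (a * x) ^+ n = 0) ->
  jacobson_radical R x.
Proof.
move=> nilx M maxM; have [lM _ _] := maxM; apply: contrapT => nMx.
have [m Mm [a E]] := maximal_left_ideal_comax 1 maxM nMx.
have [n axn] := nilx a; apply: (maximal_left_ideal_one maxM).
have <- : (\sum_(i < n) (a * x) ^+ i) * m = 1.
  have -> : m = 1 - a * x by rewrite E addrK.
  suff H i : (\sum_(j < i) (a * x) ^+ j) * (1 - a * x) = 1 - (a * x) ^+ i.
    by rewrite H axn subr0.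
  elim: i => [|i IHi]; first by rewrite big_ord0 mul0r expr0 subrr.
  by rewrite big_ord_recr /= mulrDl IHi mulrBr mulr1 -exprSr addrA subrK.
exact: left_idealMl.
Qed.

(** The elementwise form of primeness, from the annihilators [I] and [J] below. *)
Lemma prime_ringP : prime_ring R ->
  forall x y, (forall r, x * r * y = 0) -> x = 0 \/ y = 0.
Proof.
move=> prR x y xRy.
pose I : set R := [set a | forall r, a * r * y = 0].
pose J : set R := [set b | forall a, I a -> forall r, a * r * b = 0].
have IJ : two_sided_ideal I.
  split; last by move=> a s Ia r /=; rewrite -[a * s * r]mulrA; apply: Ia.
  apply/left_idealP; split=> [r|s a b Ia Ib r] /=; first by rewrite !mul0r.
  by rewrite !mulrDl Ib addr0 -[s * a * r]mulrA -[s * (a * r) * y]mulrA Ia mulr0.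
have JJ : two_sided_ideal J.
  split; last by move=> b s Jb a Ia r /=; rewrite mulrA Jb // mul0r.
  apply/left_idealP; split=> [a Ia r|s b c Jb Jc a Ia r] /=; first by rewrite mulr0.
  by rewrite mulrDr Jc // addr0 mulrA -(mulrA a r s) Jb.
have [|E|E] := prR I J IJ JJ; first by move=> a b Ia Jb; rewrite -[a]mulr1 Jb.
  by left; have : I x by []; rewrite E.
right; have Jy : J y by move=> a Ia r; apply: Ia.
by move: Jy; rewrite E.
Qed.

End RingTheory.

(** * The quotient of a ring by a left ideal as a module *)

Section QuotientModule.
Local Open Scope quotient_scope.
Variables (R : nzRingType) (M : set R).
Hypothesis lM : left_ideal M.

(** The proof is an argument, so that a closedness instance can be attached to the
    predicate. *)
Definition lideal_pred of left_ideal M : {pred R} := mem M.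

Lemma lideal_pred_zmod : zmod_closed (lideal_pred lM).
Proof.
split; first by apply/mem_set; case/left_idealP: lM.
move=> x y xM yM; apply/mem_set; apply: left_idealB => //; exact: set_mem.
Qed.

HB.instance Definition _ :=
  GRing.isZmodClosed.Build R (lideal_pred lM) lideal_pred_zmod.

Definition lideal_zmod : zmodClosed R := lideal_pred lM.

Definition lquot : Type := Quotient.quot lideal_zmod.
HB.instance Definition _ := GRing.Zmodule.on lquot.
HB.instance Definition _ := Quotient.on lquot.

Definition lquot_pi (x : R) : lquot := \pi x.

Lemma lquot_piP x y : lquot_pi x = lquot_pi y <-> M (x - y).
Proof.
split=> [/eqP|Mxy].
  by rewrite -Quotient.idealrBE => /set_mem.
by apply/eqP; rewrite -Quotient.idealrBE; apply/mem_set.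
Qed.

Lemma lquot_surj (q : lquot) : exists x, q = lquot_pi x.
Proof. by exists (generic_quotient.repr q); rewrite /lquot_pi generic_quotient.reprK. Qed.

Lemma lquot_piD x y : lquot_pi (x + y) = lquot_pi x + lquot_pi y.
Proof. exact: (raddfD (\pi_(Quotient.quot lideal_zmod))). Qed.

Definition lquot_scale (a : R) (q : lquot) : lquot :=
  lquot_pi (a * generic_quotient.repr q).

Lemma lquot_scaleE a x : lquot_scale a (lquot_pi x) = lquot_pi (a * x).
Proof.
apply/lquot_piP; rewrite -mulrBr; apply: left_idealMl => //.
by apply/lquot_piP; rewrite /lquot_pi generic_quotient.reprK.
Qed.

Lemma lquot_scaleA a b q :
  lquot_scale a (lquot_scale b q) = lquot_scale (a * b) q.
Proof. by have [x ->] := lquot_surj q; rewrite !lquot_scaleE mulrA. Qed.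

Lemma lquot_scale1 : left_id 1 lquot_scale.
Proof. by move=> q; have [x ->] := lquot_surj q; rewrite lquot_scaleE mul1r. Qed.

Lemma lquot_scaleDr : right_distributive lquot_scale +%R.
Proof.
move=> a p q; have [x ->] := lquot_surj p; have [y ->] := lquot_surj q.
by rewrite -lquot_piD !lquot_scaleE mulrDr lquot_piD.
Qed.

Lemma lquot_scaleDl q : {morph lquot_scale^~ q : a b / a + b}.
Proof.
by move=> a b; have [x ->] := lquot_surj q; rewrite !lquot_scaleE mulrDl lquot_piD.
Qed.

HB.instance Definition _ := GRing.Zmodule_isLmodule.Build R lquot
  lquot_scaleA lquot_scale1 lquot_scaleDr lquot_scaleDl.

Lemma lquot_scalerE a x : a *: lquot_pi x = lquot_pi (a * x).
Proof. exact: lquot_scaleE. Qed.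

Lemma lquot_pi0 : lquot_pi 0 = 0.
Proof. exact: (raddf0 (\pi_(Quotient.quot lideal_zmod))). Qed.

Lemma lquot_pi_eq0 x : lquot_pi x = 0 <-> M x.
Proof. by rewrite -lquot_pi0 lquot_piP subr0. Qed.

End QuotientModule.

Lemma lquot_simple (R : nzRingType) (M : set R) (maxM : maximal_left_ideal M)
  (lM : left_ideal M) : simple_module (lquot lM).
Proof.
split.
  exists (lquot_pi lM 1) => /lquot_pi_eq0; exact: maximal_left_ideal_one.
move=> U /submoduleP[U0 Ul].
have [[u Uu nu]|nU] := pselect (exists2 u, U u & u <> 0); last first.
  left; apply/seteqP; split=> [u Uu /=|_ -> //].
  by apply: contrapT => nu; apply: nU; exists u.
right; apply/seteqP; split=> // q _; have [y ->] := lquot_surj q.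
have [x Ex] := lquot_surj u; rewrite {}Ex in Uu nu.
have nMx : ~ M x by move=> /lquot_pi_eq0 => /(_ lM).
have [m Mm [a ->]] := maximal_left_ideal_comax y maxM nMx.
rewrite addrC lquot_piD -lquot_scalerE.
by apply: Ul => //; have /lquot_pi_eq0-> := Mm.
Qed.

(** A maximal left ideal [M] containing [1 - a] contains no nonzero two-sided
    ideal: it contains [a ^ n - 1] for every [n], so a power of [a] in [M] would put
    [1] into [M].  Hence the simple module [R / M] is faithful. *)
Lemma primitive_of_power_in_ideals (R : nzRingType) (a : R) :
  (forall b, b * (1 - a) <> 1) ->
  (forall I, two_sided_ideal I -> (exists2 x, I x & x <> 0) ->
     exists n, I (a ^+ n)) ->
  primitive_ring R.
Proof.
move=> ninv Ia; have [|M maxM aM] :=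
    maximal_left_ideal_above (principal_left_ideal (1 - a)).
  by move=> [b _]; exact: ninv.
have [lM _ _] := maxM.
exists (lquot lM); split; first exact: lquot_simple.
pose I : set R := [set r | forall x, M (r * x)].
have II : two_sided_ideal I.
  split; last by move=> r s Ir x /=; rewrite -mulrA; apply: Ir.
  apply/left_idealP; split=> [x|s r t Ir It x] /=.
    by rewrite mul0r; case/left_idealP: lM.
  by rewrite mulrDl -mulrA; apply: left_idealD => //; apply: left_idealMl.
move=> r r0; apply: contrapT => nr.
have [|n /(_ 1)] := Ia _ II.
  by exists r => // x; apply/(lquot_pi_eq0 lM); rewrite -lquot_scalerE.
rewrite mulr1 => Man; apply: (maximal_left_ideal_one maxM).
elim: n Man => // n IHn; rewrite exprSr => Man; apply: IHn.
rewrite -(subrK (a ^+ n * a) (a ^+ n)); apply: left_idealD => //.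
by apply: aM; exists (a ^+ n); rewrite // mulrBr mulr1.
Qed.

(** * Standard identities *)

Section StandardIdentity.
Variable R : nzRingType.

Definition standard_poly m (a : 'I_m -> R) : R :=
  \sum_(s : 'S_m) (-1) ^+ s * \prod_(i < m) a (s i).

Definition central (c : R) : Prop := forall x, c * x = x * c.

Definition update (I : eqType) (a : I -> R) i0 x : I -> R :=
  fun i => if i == i0 then x else a i.

Lemma standard_poly_repeat m (a : 'I_m -> R) i j :
  i != j -> a i = a j -> standard_poly a = 0.
Proof.
move=> nij Eij; pose t := tperm i j.
have at_ x : a (t x) = a x by rewrite /t; case: tpermP => // ->.
rewrite /standard_poly (bigID (@odd_perm _)) /=.
apply: canLR (subrK _) _; rewrite add0r -sumrN.
rewrite (reindex_inj (mulIg t)); apply: eq_big => [s|s].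
  by rewrite odd_permM odd_tperm nij addbT.
rewrite odd_permM odd_tperm nij addbT => /negPf->; rewrite mulN1r mul1r.
by congr (- _); apply: eq_bigr => /= l _; rewrite permM at_.
Qed.

Lemma prod_update (I : eqType) (J : finType) (a : I -> R) i0 (c x : J -> R) r :
  (forall j, central (c j)) -> uniq r -> i0 \in r ->
  \prod_(i <- r) update a i0 (\sum_j c j * x j) i =
  \sum_j c j * \prod_(i <- r) update a i0 (x j) i.
Proof.
move=> cc; elim: r => //= i r IHr /andP[nir ur]; rewrite inE.
have [-> _|ni0 /= /(IHr ur) E] := eqVneq i0 i.
  have out y : \prod_(l <- r) update a i y l = \prod_(l <- r) a l.
    apply: eq_big_seq => l lr; rewrite /update; case: eqP => // E.
    by rewrite E (negPf nir) in lr.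
  rewrite big_cons out {1}/update eqxx mulr_suml; apply: eq_bigr => j _.
  by rewrite big_cons out /update eqxx mulrA.
rewrite big_cons {}E mulr_sumr; apply: eq_bigr => j _.
rewrite big_cons {1 3}/update [i == i0]eq_sym (negPf ni0).
by rewrite mulrA -cc mulrA.
Qed.

Lemma standard_poly_update m (J : finType) (a : 'I_m -> R) i0 (c x : J -> R) :
  (forall j, central (c j)) ->
  standard_poly (update a i0 (\sum_j c j * x j)) =
  \sum_j c j * standard_poly (update a i0 (x j)).
Proof.
move=> cc; under [RHS]eq_bigr do rewrite mulr_sumr.
rewrite exchange_big /=; apply: eq_bigr => s _.
under [RHS]eq_bigr do rewrite mulrA cc -mulrA.
rewrite -mulr_sumr; congr (_ * _).
pose r := [seq s i | i <- index_enum 'I_m].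
have E y : \prod_(i < m) update a i0 y (s i) = \prod_(i <- r) update a i0 y i.
  by rewrite big_map.
rewrite E prod_update //; first by under [RHS]eq_bigr do rewrite E.
  by rewrite map_inj_uniq ?index_enum_uniq //; apply: perm_inj.
by apply/mapP; exists (s^-1%g i0); rewrite ?mem_index_enum // permKV.
Qed.

(** The standard polynomial is multilinear over the center and vanishes when two
    arguments coincide. *)
Lemma standard_identity_central_span (I : finType) (g : I -> R) m :
  (forall x, exists2 c : I -> R, forall i, central (c i) &
     x = \sum_i c i * g i) ->
  (#|I| < m)%N -> standard_identity R m.
Proof.
move=> span lt_m a; rewrite -/(standard_poly a).
(* By induction on [n], the arguments of index at least [n] being in the spanning
   family: the argument of index [n] is expanded to pass from [n] to [n + 1], and
   for [n = 0] two arguments coincide by the pigeonhole principle. *)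
have H n : forall b : 'I_m -> R, (forall i : 'I_m, (n <= i)%N -> exists j, b i = g j) ->
    standard_poly b = 0.
  elim: n => [|n IHn] b Hb.
    have /choice[f Hf] : forall i, exists j, b i = g j by move=> i; apply: Hb.
    have : ~~ injectiveb f.
      by apply/negP => /injectiveP /leq_card; rewrite card_ord leqNgt lt_m.
    case/injectivePn => i [j nij Eij].
    by apply: (standard_poly_repeat nij); rewrite !Hf Eij.
  have [lt_nm|le_mn] := ltnP n m; last first.
    by apply: IHn => i le_ni; have := ltn_ord i; rewrite ltnNge (leq_trans le_mn le_ni).
  pose i0 := Ordinal lt_nm; have [c cc E] := span (b i0).
  have -> : b = update b i0 (\sum_i c i * g i).
    by apply: funext => i; rewrite /update; case: eqP => // ->.
  rewrite standard_poly_update // big1 // => j _; rewrite IHn ?mulr0 // => i le_ni.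
  rewrite /update; case: eqP => [_|ni]; first by exists j.
  apply: Hb; rewrite ltn_neqAle le_ni andbT; apply/eqP => E'.
  by apply: ni; apply: val_inj.
by apply: (H m) => i; rewrite leqNgt ltn_ord.
Qed.

End StandardIdentity.

(** * Monomial bases *)

(** The nonzero [mon w] form a basis of [A], multiplied by concatenation; [coef w]
    is the corresponding coordinate function, and it is zero when [mon w] is. *)
Record monomial_basis (k : fieldType) (A : algType k) (T : finType) := {
  mon : seq T -> A;
  coef : seq T -> A -> k;
  mon_nil : mon [::] = 1;
  mon_cat : forall u v, mon (u ++ v) = mon u * mon v;
  coef_is_linear : forall w c a b, coef w (c *: a + b) = c * coef w a + coef w b;
  coef_mon : forall u v, coef u (mon v) = ((mon u != 0) && (u == v))%:R;
  mon_span : forall a, exists2 s, uniq s & a = \sum_(w <- s) coef w a *: mon w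
}.

Section FreeAlgebra.
Variables (k : fieldType) (d : nat).
Local Notation F := {malg k[{fmonom 'I_d}]}.
Local Notation word := (seq 'I_d).

Definition gen (w : word) : F := mkmalgU (FMonom w) 1.

Lemma gen_cat u v : gen (u ++ v) = gen u * gen v.
Proof.
rewrite malgM_def fgmulUU mulr1 /gen; congr mkmalgU; exact: esym (fmmulE (FMonom u) (FMonom v)).
Qed.

Lemma gen_nil : gen [::] = 1.
Proof. by rewrite /gen -fmoneE. Qed.

Lemma gen_val (m : {fmonom 'I_d}) : gen m = mkmalgU m 1.
Proof. by rewrite /gen fmK. Qed.

Lemma mcoeff_gen u v : mcoeff (FMonom u) (gen v) = (u == v)%:R.
Proof. by rewrite mcoeffU eq_sym fmP. Qed.

Lemma gen_span (p : F) :
  p = \sum_(m <- msupp p) mcoeff m p *: gen m.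
Proof.
rewrite {1}(monalgE p); apply: eq_bigr => m _; rewrite gen_val.
by apply/malgP => m'; rewrite mcoeffZ !mcoeffU mulrnAr mulr1.
Qed.

(** This description of the kernel shows that the coefficients of the words
    avoiding [S] are well defined on the quotient. *)
Lemma word_ideal (S : set {fmonom 'I_d}) :
  smallest (@two_sided_ideal F) [set mkmalgU w (1 : k) | w in S] =
  [set p : F | forall w, mcoeff (FMonom w) p != 0 -> exists2 s, S s & infix s w].
Proof.
apply/seteqP; split.
  apply: smallest_sub; last first.
    move=> _ [s Ss <-] w; rewrite -gen_val mcoeff_gen.
    by have [->|_] := eqVneq w s; [exists s => //; exact: infix_refl | rewrite eqxx].
  have mulP (p q : F) w : mcoeff (FMonom w) (p * q) != 0 -> exists u v,
      [/\ mcoeff (FMonom u) p != 0, mcoeff (FMonom v) q != 0 & w = u ++ v].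
    rewrite mcoeff_neq0 => /msuppM_le[m1 [m2 [m1p m2q E]]].
    exists m1, m2; rewrite !fmK !mcoeff_neq0; split=> //.
    by have := congr1 (@fmonom_val _) E; rewrite fmM.
  split.
    apply/left_idealP; split=> [w|a x y Ix Iy w]; first by rewrite mcoeff0 eqxx.
    rewrite mcoeffD; have [E|/mulP[u [v [_ /Ix[s Ss sv] ->]]] _] :=
        eqVneq (mcoeff (FMonom w) (a * x)) 0; first by rewrite E add0r; apply: Iy.
    by exists s => //; apply: infix_catl.
  move=> x r Ix w /mulP[u [v [/Ix[s Ss su] _ ->]]].
  by exists s => //; apply: infix_catr.
move=> p Np I [[/left_idealP[I0 Il] Ir] genI].
rewrite (gen_span p); elim/big_ind: _ => //.
  by move=> x y Ix Iy; rewrite -[x]mul1r; apply: Il.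
move=> m _; have [->|nz] := eqVneq (mcoeff m p) 0; first by rewrite scale0r.
have [|s Ss /infixP[u [v E]]] := Np m; first by rewrite fmK.
rewrite E !gen_cat scalerAl -[X in I X]addr0; apply: Il => //.
by apply: Ir; rewrite gen_val; apply: genI; exists s.
Qed.

End FreeAlgebra.

Lemma monomial_algebra_basis (k : fieldType) (A : algType k) :
  monomial_algebra A -> exists d, inhabited (monomial_basis A 'I_d).
Proof.
move=> [d [S [f [surjf kerf]]]]; exists d.
rewrite word_ideal in kerf.
have /choice[lift liftK] : forall a, exists p, f p = a by [].
pose red (w : seq 'I_d) := `[< exists2 s, S s & infix s w >].
pose mon w := f (gen k w).
pose coef w a := if red w then 0 else mcoeff (FMonom w) (lift a).
have kerP p : f p = 0 <-> forall w, mcoeff (FMonom w) p != 0 -> red w.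
  split=> [fp w nz|H].
    have : (f @^-1` [set 0]) p by [].
    by rewrite kerf => /(_ w nz) ?; apply/asboolP.
  suff : (f @^-1` [set 0]) p by [].
  by rewrite kerf => w /H /asboolP.
have mon0 w : (mon w == 0) = red w.
  apply/eqP/idP => [/kerP/(_ w)|rw]; first by rewrite mcoeff_gen eqxx oner_eq0; apply.
  by apply/kerP => v; rewrite mcoeff_gen; have [->//|_] := eqVneq v w; rewrite eqxx.
have coef_f w p : coef w (f p) = if red w then 0 else mcoeff (FMonom w) p.
  rewrite /coef; case: ifP => // nr; apply/eqP; rewrite -subr_eq0 -mcoeffB.
  apply: contraFT nr => nz; have /kerP -> // : f (lift (f p) - p) = 0.
  by rewrite raddfB /= liftK subrr.
constructor; apply: (@Build_monomial_basis _ _ _ mon coef).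
- by rewrite /mon gen_nil rmorph1.
- by move=> u v; rewrite /mon gen_cat rmorphM.
- move=> w c a b; rewrite -{1}(liftK a) -{1}(liftK b) -linearP coef_f /coef.
  by case: ifP => _; rewrite ?mulr0 ?addr0 // mcoeffD mcoeffZ.
- by move=> u v; rewrite coef_f mon0 mcoeff_gen; case: (red u).
- move=> a; exists (map (@fmonom_val 'I_d) (enum_fset (msupp (lift a)))).
    by rewrite map_inj_uniq ?fset_uniq //; apply: val_inj.
  rewrite big_map -{1}(liftK a) {1}(gen_span (lift a)) raddf_sum /=.
  apply: eq_bigr => m _; rewrite linearZ /= -/(mon m) /coef fmK.
  by case: ifP => // rm; move: (mon0 m); rewrite rm => /eqP->; rewrite !scaler0.
Qed.

(** * Coefficients of products *)

Section MonomialBasis.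
Variables (k : fieldType) (A : algType k) (T : finType).
Variable X : monomial_basis A T.
Implicit Types (p q u v w z : seq T) (a b f g : A).

Local Notation mon := (mon X).
Local Notation coef := (coef X).

Definition lang : set (seq T) := [set w | mon w != 0].

HB.instance Definition _ w :=
  GRing.isLinear.Build k A k *%R (coef w) (coef_is_linear X w).

Lemma mon_ind (P : A -> Prop) : P 0 ->
  (forall c a b, P a -> P b -> P (c *: a + b)) -> (forall w, P (mon w)) ->
  forall a, P a.
Proof.
move=> P0 PD Pm a; have [s _ ->] := mon_span X a.
elim: s => [|w s IHs]; first by rewrite big_nil.
by rewrite big_cons; apply: PD.
Qed.

Lemma coef_support a : exists2 s, uniq s & forall w, coef w a != 0 -> w \in s.
Proof.
have [s us E] := mon_span X a; exists s => // w; rewrite {1}E raddf_sum /=.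
apply: contraNT => nws; rewrite big_seq big1 // => v vs.
rewrite linearZ /= coef_mon; have [E'|_] := eqVneq w v; last by rewrite andbF mulr0.
by rewrite E' vs in nws.
Qed.

Lemma coef_ext a b : (forall w, coef w a = coef w b) -> a = b.
Proof.
move=> E; apply/eqP; rewrite -subr_eq0; have [s _ ->] := mon_span X (a - b).
by rewrite big1 // => w _; rewrite raddfB /= E subrr scale0r.
Qed.

Lemma coef_lang w a : coef w a != 0 -> lang w.
Proof.
apply: contraNT => /negPn /eqP mw0; apply/eqP; elim/mon_ind: a.
- exact: raddf0.
- by move=> c a b Ea Eb; rewrite linearP /= Ea Eb mulr0 addr0.
- by move=> v; rewrite coef_mon mw0 eqxx.
Qed.

Lemma coef_lang_mon w v : lang w -> coef w (mon v) = (w == v)%:R.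
Proof. by rewrite coef_mon => ->. Qed.

Lemma coef_one w : lang w -> coef w 1 = (w == [::])%:R.
Proof. by rewrite -(mon_nil X); exact: coef_lang_mon. Qed.

Lemma lang_factorial : factorial lang.
Proof.
move=> u w /infixP[p [q ->]]; apply: contraNN => /eqP mu0.
by rewrite !mon_cat mu0 mul0r mulr0.
Qed.

(** Only words outside the language are sent to zero, so for [z] in the language
    the product is the convolution of the free algebra. *)
Lemma coefM z a b : lang z ->
  coef z (a * b) =
  \sum_(i < (size z).+1) coef (take i z) a * coef (drop i z) b.
Proof.
move=> Lz; elim/mon_ind: a => [|c a a' IHa IHa'|u].
- by rewrite mul0r raddf0 big1 // => i _; rewrite raddf0 mul0r.
- rewrite mulrDl -scalerAl linearP /= IHa IHa' mulr_sumr -big_split /=.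
  by apply: eq_bigr => i _; rewrite linearP /= mulrDl mulrA.
elim/mon_ind: b => [|c b b' IHb IHb'|v].
- by rewrite mulr0 raddf0 big1 // => i _; rewrite raddf0 mulr0.
- rewrite mulrDr -scalerAr linearP /= IHb IHb' mulr_sumr -big_split /=.
  by apply: eq_bigr => i _; rewrite linearP /= mulrDr mulrCA.
rewrite -mon_cat coef_lang_mon //.
have E i : coef (take i z) (mon u) * coef (drop i z) (mon v) =
    ((take i z == u) && (drop i z == v))%:R.
  have Lt := factorial_take i lang_factorial Lz.
  have Ld := factorial_drop i lang_factorial Lz.
  by rewrite !coef_lang_mon // -natrM mulnb.
under eq_bigr do rewrite E.
have [->|nz] := eqVneq z (u ++ v); last first.
  rewrite big1 // => i _; case: eqP => // Eu; case: eqP => // Ev.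
  by case/eqP: nz; rewrite -Eu -Ev cat_take_drop.
have lt_u : (size u < (size (u ++ v)).+1)%N by rewrite ltnS size_cat leq_addr.
rewrite (bigD1 (Ordinal lt_u)) //= take_size_cat // drop_size_cat // !eqxx.
rewrite big1 ?addr0 // => i /eqP ni; case: eqP => // Eu.
case: ni; apply: val_inj => /=; have := congr1 size Eu.
by rewrite size_takel // -ltnS.
Qed.

Lemma coef_mul_mon a w q : lang (w ++ q) -> coef (w ++ q) (a * mon q) = coef w a.
Proof.
move=> Lwq; have Lw := factorial_catl lang_factorial Lwq.
elim/mon_ind: a => [|c a b IHa IHb|u].
- by rewrite mul0r !raddf0.
- by rewrite mulrDl -scalerAl !linearP /= IHa IHb.
- rewrite -mon_cat !coef_lang_mon //; congr (_%:R : k); congr nat_of_bool.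
  by apply/eqP/eqP => [/cat_injl|->].
Qed.

Lemma coef_mon_mul a p w : lang (p ++ w) -> coef (p ++ w) (mon p * a) = coef w a.
Proof.
move=> Lpw; have Lw := factorial_catr lang_factorial Lpw.
elim/mon_ind: a => [|c a b IHa IHb|u].
- by rewrite mulr0 !raddf0.
- by rewrite mulrDr -scalerAr !linearP /= IHa IHb.
- rewrite -mon_cat !coef_lang_mon //; congr (_%:R : k); congr nat_of_bool.
  by apply/eqP/eqP => [/cat_injr|->].
Qed.

Lemma coef_sandwich a p w q : lang (p ++ w ++ q) ->
  coef (p ++ w ++ q) (mon p * a * mon q) = coef w a.
Proof.
move=> L1; rewrite -mulrA coef_mon_mul // coef_mul_mon //.
exact: factorial_catr lang_factorial L1.
Qed.

Lemma coef_mul_mon_split a z q : coef z (a * mon q) != 0 -> exists w, z = w ++ q.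
Proof.
move=> nz; apply: contrapT => H; case/eqP: nz; elim/mon_ind: a.
- by rewrite mul0r raddf0.
- by move=> c a b Ea Eb; rewrite mulrDl -scalerAl linearP /= Ea Eb mulr0 addr0.
- move=> u; rewrite -mon_cat coef_mon; case: (z =P _) => [E|_]; last by rewrite andbF.
  by case: H; exists u.
Qed.

Lemma coef_mon_mul_split a p z : coef z (mon p * a) != 0 -> exists w, z = p ++ w.
Proof.
move=> nz; apply: contrapT => H; case/eqP: nz; elim/mon_ind: a.
- by rewrite mulr0 raddf0.
- by move=> c a b Ea Eb; rewrite mulrDr -scalerAr linearP /= Ea Eb mulr0 addr0.
- move=> u; rewrite -mon_cat coef_mon; case: (z =P _) => [E|_]; last by rewrite andbF.
  by case: H; exists u.
Qed.

Lemma coef_sandwich_split a p z q : coef z (mon p * a * mon q) != 0 ->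
  exists w, z = p ++ w ++ q.
Proof.
move=> nz; have Lz := coef_lang nz.
have [y E] := coef_mul_mon_split nz; rewrite E in nz Lz *.
rewrite coef_mul_mon // in nz; have [w ->] := coef_mon_mul_split nz.
by exists w; rewrite catA.
Qed.

Lemma coefM_split z a b : coef z (a * b) != 0 ->
  exists u v, [/\ z = u ++ v, coef u a != 0 & coef v b != 0].
Proof.
move=> nz; have Lz := coef_lang nz; apply: contrapT => H; case/eqP: nz.
rewrite coefM // big1 // => i _; apply/eqP; apply: contrapT => /negP nz; apply: H.
exists (take i z), (drop i z); rewrite cat_take_drop; split=> //.
  by apply: contraNneq nz => ->; rewrite mul0r.
by apply: contraNneq nz => ->; rewrite mulr0.
Qed.

(** * Ideals modulo the words outside a minimal language *)

Variable K : set (seq T).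
Hypotheses (mK : minimal_lang K) (KL : K `<=` lang).

Let fK : factorial K := mK.1.1.

Definition support_in a (s : seq (seq T)) : Prop :=
  uniq s /\ forall w, w \in s <-> K w /\ coef w a != 0.

Lemma support_in_exists a : exists s, support_in a s.
Proof.
have [s us Hs] := coef_support a.
exists [seq w <- s | (w \in K) && (coef w a != 0)]; split; first exact: filter_uniq.
move=> w; rewrite mem_filter; split.
  by case/andP=> /andP[/set_mem Kw nz] _.
by case=> /mem_set-> nz; rewrite nz Hs.
Qed.

Lemma support_in_sandwich a s p q : support_in a s ->
  support_in (mon p * a * mon q)
    [seq p ++ w ++ q | w <- s & (p ++ w ++ q) \in K].
Proof.
move=> [us Hs]; split.
  rewrite map_inj_uniq ?filter_uniq // => u v /cat_injr; exact: cat_injl.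
move=> z; split.
  case/mapP=> w; rewrite mem_filter => /andP[/set_mem Kw /Hs[_ nz]] ->.
  by split=> //; rewrite coef_sandwich //; apply: KL.
case=> Kz nz; have [w E] := coef_sandwich_split nz; rewrite E in nz Kz *.
apply/map_f; rewrite mem_filter mem_set //=; apply/Hs; split.
  exact: factorial_mid Kz.
by rewrite coef_sandwich // in nz; apply: KL.
Qed.

(** An element of an ideal with the fewest possible words of [K] in it: all of
    these words have the same contexts in [K], otherwise multiplication by some
    [p] and [q] would remove some of them but not all. *)
Lemma congruent_support_in_ideal (I : set A) a s :
  two_sided_ideal I -> I a -> support_in a s -> s <> [::] ->
  exists b t, [/\ I b, support_in b t, t <> [::] &
    forall u v, u \in t -> v \in t -> congruent K u v].
Proof.
move=> [lI rI]; elim: (size s).+1 {-2}s a (ltnSn (size s)) => // n IHn {}s a le_n Ia sa s0.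
have [cong|] := pselect (forall u v, u \in s -> v \in s -> congruent K u v).
  by exists a, s.
move=> ncong; have [u [v [p [q [us vs nKu Kv]]]]] : exists u v p q,
    [/\ u \in s, v \in s, ~ K (p ++ u ++ q) & K (p ++ v ++ q)].
  apply: contrapT => H; apply: ncong => u v us vs p q; split=> Kp.
    by apply: contrapT => nK; apply: H; exists v, u, p, q.
  by apply: contrapT => nK; apply: H; exists u, v, p, q.
apply: (IHn _ _ _ _ (support_in_sandwich p q sa)).
- rewrite ltnS in le_n; rewrite size_map size_filter (leq_trans _ le_n) // ltn_neqAle count_size andbT.
  rewrite -all_count; apply/allPn; exists u => //; apply/negP => /set_mem.
  exact: nKu.
- by apply: rI; apply: left_idealMl.
- have : p ++ v ++ q \in [seq p ++ w ++ q | w <- s & (p ++ w ++ q) \in K].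
    by apply/map_f; rewrite mem_filter vs andbT; apply/mem_set.
  by move=> H E; rewrite E in H.
Qed.

(** If a single word of [K] occurs, every long word of [K] contains it, and so
    the ideal contains all words of [K] of some length, modulo words outside
    [K]. *)
Lemma ideal_contains_all_long_words (I : set A) a w :
  two_sided_ideal I -> I a -> support_in a [:: w] ->
  exists2 N, (0 < N)%N & exists2 b, I b &
    forall z, K z -> coef z b = (size z == N)%:R.
Proof.
move=> [lI rI] Ia [_ sa]; have [Kw nzw] := (sa w).1 (mem_head _ _).
have [N HN] := minimal_lang_uniform mK Kw.
exists N.+1 => //.
have one z : K z -> size z = N.+1 ->
    exists2 b, I b & forall y, K y -> coef y b = (y == z)%:R.
  move=> Kz sz; have /infixP[p [q Ez]] : infix w z by apply: HN => //; rewrite sz.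
  exists ((coef w a)^-1 *: (mon p * a * mon q)).
    rewrite -mulr_algl; apply: left_idealMl => //; apply: rI; exact: left_idealMl.
  move=> y Ky; rewrite linearZ /=; have [->|nyz] := eqVneq y z.
    by rewrite Ez coef_sandwich ?mulVf // -Ez; apply: KL.
  have [->|nz] := eqVneq (coef y (mon p * a * mon q)) 0; first by rewrite mulr0.
  have [w' Ey] := coef_sandwich_split nz; rewrite Ey in Ky nz nyz *.
  have : w' \in [:: w].
    apply/sa; split; first exact: factorial_mid Ky.
    by rewrite coef_sandwich // in nz; apply: KL.
  by rewrite inE => /eqP E; rewrite E -Ez eqxx in nyz.
have many (s : seq (seq T)) : uniq s -> {subset s <= words_of_length K N.+1} ->
    exists2 b, I b & forall y, K y -> coef y b = (y \in s)%:R.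
  elim: s => [_ _|z s IHs /= /andP[nzs us] sub].
    by exists 0; [case/left_idealP: lI | move=> y _; rewrite raddf0].
  have [|b Ib Hb] := IHs us; first by move=> y ys; apply: sub; rewrite inE ys orbT.
  have := sub z (mem_head _ _); rewrite mem_words_of_length => /andP[/set_mem Kz /eqP sz].
  have [c Ic Hc] := one z Kz sz; exists (c + b); first exact: left_idealD.
  move=> y Ky; rewrite raddfD /= Hb // Hc // inE.
  by have [->|] := eqVneq y z; rewrite ?(negPf nzs) ?addr0 ?add0r.
have [b Ib Hb] := many _ (uniq_words_of_length K N.+1) (fun _ => id).
by exists b => // z Kz; rewrite Hb // mem_words_of_length mem_set.
Qed.

(** A left inverse [b = 1 + b g] has coefficient [1] at each word of [K] whose
    length is a multiple of [N], by removing suffixes of length [N]; but there are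
    infinitely many such words. *)
Lemma sub_one_not_left_invertible_uniform N g b : (0 < N)%N ->
  (forall z, K z -> coef z g = (size z == N)%:R) -> b * (1 - g) <> 1.
Proof.
move=> N_gt0 Hg E; have Eb : b = 1 + b * g.
  by rewrite -[in RHS]E mulrBr mulr1 subrK.
have coefb j z : K z -> size z = (j * N)%N -> coef z b = 1.
  elim: j z => [|j IHj] z Kz sz; rewrite Eb raddfD /= coef_one ?coefM //;
    try exact: KL.
    rewrite mul0n in sz; rewrite (size0nil sz) eqxx big1 ?addr0 // => i _.
    rewrite Hg; last by rewrite /= (size0nil sz) in Kz *.
    by rewrite /= eq_sym (gtn_eqF N_gt0) mulr0.
  have zN : (j * N < (size z).+1)%N by rewrite sz ltnS mulSn leq_addl.
  have -> : (z == [::]) = false by apply/eqP => z0; rewrite z0 mulSn /= in sz; lia.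
  rewrite add0r (bigD1 (Ordinal zN)) //= Hg; last exact: factorial_drop.
  rewrite size_drop {1}sz mulSn addnK eqxx mulr1 IHj; last 2 first.
  - exact: factorial_take.
  - by rewrite size_takel // -ltnS.
  rewrite big1 ?addr0 // => i ni; rewrite Hg; last exact: factorial_drop.
  rewrite size_drop; case: eqP => [E'|_]; last by rewrite mulr0.
  case/eqP: ni; apply: val_inj => /=; have := ltn_ord i.
  have : size z = (N + j * N)%N by rewrite sz mulSn.
  lia.
have [s us Hs] := coef_support b.
have [z Kz sz] := mK.1.2 ((\max_(w <- s) size w).+1 * N)%N.
have zs : z \in s by apply: Hs; rewrite (coefb _ _ Kz sz) oner_eq0.
have := leq_bigmax_seq z zs isT (F := size); rewrite sz; nia.
Qed.

(** Let [w] and [y] be the longest words commuting with [v] that occur in [g] and in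
    a left inverse [b = 1 + b g].  Then [y w] is in [K] and occurs in [b g], the
    only contribution to its coefficient being that of [y] and [w], although it is
    longer than [y]. *)
Lemma sub_one_not_left_invertible_commuting v g b : v <> [::] ->
  (forall y, commutes y v -> K y) ->
  (forall w, K w -> coef w g != 0 -> commutes w v) ->
  (exists2 w, K w /\ w <> [::] & coef w g != 0) -> b * (1 - g) <> 1.
Proof.
move=> v0 Kv Hg [w0 [Kw0 w00] nz0] E; have Eb : b = 1 + b * g.
  by rewrite -[in RHS]E mulrBr mulr1 subrK.
have longest c : (exists2 w, K w /\ commutes w v & coef w c != 0) ->
    exists w, [/\ K w, commutes w v, coef w c != 0 &
      forall y, K y -> commutes y v -> coef y c != 0 -> (size y <= size w)%N].
  move=> [w [Kw wv] nz]; have [s us Hs] := coef_support c.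
  pose P n := `[< exists w, [/\ K w, commutes w v, coef w c != 0 & size w = n] >].
  have P0 : exists n, P n by exists (size w); apply/asboolP; exists w.
  have Pub n : P n -> (n <= \max_(w <- s) size w)%N.
    move=> /asboolP[y [_ _ nzy <-]]; exact: (leq_bigmax_seq y (Hs _ nzy)).
  case: (ex_maxnP P0 Pub) => n /asboolP[y [Ky yv nzy sy]] maxn; exists y; split=> //.
  by move=> y' Ky' yv' nzy'; rewrite sy; apply: maxn; apply/asboolP; exists y'.
have [w [Kw wv nzw maxw]] := longest g (ex_intro2 _ _ w0 (conj Kw0 (Hg _ Kw0 nz0)) nz0).
have w_gt0 : (0 < size w)%N.
  by apply: leq_trans (maxw _ Kw0 (Hg _ Kw0 nz0) nz0); case: (w0) w00.
have nilv : commutes [::] v by rewrite /commutes cats0.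
have Knil := infinite_lang_nil mK.1.
have [|y [Ky yv nzy maxy]] := longest b.
  exists [::] => //; apply/eqP => b0; have := congr1 (coef [::]) Eb.
  rewrite raddfD /= coefM ?coef_one; try exact: KL.
  by rewrite eqxx big_ord1 /= b0 mul0r addr0 => /esym/eqP; rewrite oner_eq0.
have ywv : commutes (y ++ w) v by apply: commutes_cat.
have Kyw := Kv _ ywv; have Lyw := KL Kyw.
have : coef (y ++ w) b = 0.
  apply/eqP; apply: contrapT => /negP nz.
  by have := maxy _ Kyw ywv nz; rewrite size_cat; lia.
apply/eqP; rewrite Eb raddfD /= coef_one // coefM //.
have -> : (y ++ w == [::]) = false by apply/eqP => /(congr1 size); rewrite size_cat /=; lia.
have lt_y : (size y < (size (y ++ w)).+1)%N by rewrite ltnS size_cat leq_addr.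
rewrite add0r (bigD1 (Ordinal lt_y)) //= take_size_cat // drop_size_cat //.
rewrite big1 ?addr0 ?mulf_neq0 // => i ni.
have [->|nz1] := eqVneq (coef (drop i (y ++ w)) g) 0; first by rewrite mulr0.
have [->|nz2] := eqVneq (coef (take i (y ++ w)) b) 0; first by rewrite mul0r.
have Kd : K (drop i (y ++ w)) by apply: factorial_drop.
have Kt : K (take i (y ++ w)) by apply: factorial_take.
have dv := Hg _ Kd nz1.
have tv : commutes (take i (y ++ w)) v.
  by apply: (@commutes_catl_cancel _ _ _ (drop i (y ++ w))); rewrite ?cat_take_drop.
have le1 := maxw _ Kd dv nz1; have le2 := maxy _ Kt tv nz2.
have le_i : (i <= size (y ++ w))%N by rewrite -ltnS.
case/eqP: ni; apply: val_inj => /=.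
by move: le1 le2 (size_cat y w); rewrite size_drop size_takel //; lia.
Qed.

(** Once the words of [K] occurring in an element of the ideal are congruent, the
    alternative is whether there is one of them or more.  In the second case
    [congruent_family] produces [v]. *)
Lemma ideal_dichotomy C (I : set A) f z :
  quadratic_bound K C -> two_sided_ideal I -> I f -> K z -> coef z f != 0 ->
  (exists2 N, (0 < N)%N & exists2 g, I g &
     forall w, K w -> coef w g = (size w == N)%:R) \/
  (exists v g, [/\ v <> [::], forall y, commutes y v -> K y, I g,
     forall w, K w -> coef w g != 0 -> commutes w v &
     exists2 w, K w /\ w <> [::] & coef w g != 0]).
Proof.
move=> quadK idI If Kz nz; have [s sf] := support_in_exists f.
have s0 : s <> [::] by move=> s0; have := (sf.2 z).2 (conj Kz nz); rewrite s0.
have [a [t [Ia sa t0 cong]]] := congruent_support_in_ideal idI If sf s0.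
case: t => [//|w t] in sa t0 cong *.
case: t => [|w' t] in sa t0 cong *; [left | right].
  exact: ideal_contains_all_long_words sa.
have [ut Ht] := sa; set ws := w :: w' :: t in sa t0 cong ut Ht *.
have nww' : w <> w'.
  by move=> E; move: ut; rewrite /ws E /= inE eqxx.
have [] := @congruent_family _ K C ws w w' mK quadK _ cong _ _ nww'.
- by move=> u /Ht[].
- by rewrite inE eqxx.
- by rewrite !inE eqxx orbT.
move=> x [v [v0 Kws Kv [u uws ux0]]].
exists v, (a * mon x); split=> //; first exact: idI.2.
  move=> y Ky nzy; have [y' E] := coef_mul_mon_split nzy; rewrite E in Ky nzy *.
  have y'ws : y' \in ws.
    apply/Ht; split; first exact: factorial_catl Ky.
    by rewrite coef_mul_mon // in nzy; apply: KL.
  by have [] := Kws _ y'ws.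
exists (u ++ x); first by split=> //; have [] := Kws _ uws.
have [Kux _] := Kws _ uws; rewrite coef_mul_mon; last exact: KL.
by have [] := (Ht u).1 uws.
Qed.

(** In both cases of the dichotomy the radical would contain some [g] with
    [1 - g] not left invertible. *)
Lemma jacobson_radical_coef C z f : quadratic_bound K C -> K z ->
  jacobson_radical A f -> coef z f = 0.
Proof.
move=> quadK Kz Jf; apply/eqP; apply: contrapT => /negP nz.
have [] := ideal_dichotomy quadK (jacobson_radical_ideal A) Jf Kz nz.
  move=> [N N_gt0 [g Jg Hg]]; have [b] := jacobson_radical_left_inverse Jg.
  exact: sub_one_not_left_invertible_uniform N_gt0 Hg.
move=> [v [g [v0 Kv Jg Hg nzg]]]; have [b] := jacobson_radical_left_inverse Jg.
exact: sub_one_not_left_invertible_commuting v0 Kv Hg nzg.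
Qed.

End MonomialBasis.

(** * From frames to word counts *)

Section FramePowers.
Variables (k : fieldType) (A : algType k).
Implicit Types (V : set A) (x y : A).

Lemma submodule_smallest (M : lmodType k) (G : set M) :
  submodule (smallest (@submodule k M) G).
Proof.
apply/submoduleP; split=> [U [/submoduleP[U0 _] _] //|c x y Gx Gy U [mU GU]].
have [_ Ul] := (submoduleP U).1 mU.
by apply: Ul; [exact: Gx | exact: Gy].
Qed.

(** Both factors range over spans of products, whence two linear extensions. *)
Lemma subspace_powM V i j x y : subspace_pow V i x -> subspace_pow V j y ->
  subspace_pow V (i + j) (x * y).
Proof.
move=> Vx Vy; have /submoduleP[W0 Wl] : submodule (subspace_pow V (i + j)).
  exact: submodule_smallest.
pose U1 : set A := [set x | subspace_pow V (i + j) (x * y)].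
suff : U1 x by []; apply: (smallest_sub _ _ Vx).
  apply/submoduleP; split=> [|c a b Ua Ub] /=; first by rewrite /U1 /= mul0r.
  by rewrite /U1 /= mulrDl -scalerAl; apply: Wl.
move=> _ [v Vv <-]; rewrite /U1 /=.
pose U2 : set A := [set y | subspace_pow V (i + j) (\prod_(l < i) v l * y)].
suff : U2 y by []; apply: (smallest_sub _ _ Vy).
  apply/submoduleP; split=> [|c a b Ua Ub] /=; first by rewrite /U2 /= mulr0.
  by rewrite /U2 /= mulrDr -scalerAr; apply: Wl.
move=> _ [v' Vv' <-]; rewrite /U2 /=; apply: sub_gen_smallest.
pose f := fun l : 'I_(i + j) =>
  match split l with inl l' => v l' | inr l' => v' l' end.
exists f; first by move=> l; rewrite /f; case: split.
by rewrite big_split_ord /=; congr (_ * _); apply: eq_bigr => l _;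
   rewrite /f (unsplitK (inl l)) || rewrite /f (unsplitK (inr l)).
Qed.

Lemma subspace_pow_one V n : V 1 -> subspace_pow V n 1.
Proof.
move=> V1; apply: sub_gen_smallest; exists (fun _ => 1) => //.
by rewrite big1.
Qed.

Lemma subspace_pow_le V i j x : V 1 -> (i <= j)%N ->
  subspace_pow V i x -> subspace_pow V j x.
Proof.
move=> V1 le_ij Vx; rewrite -(subnKC le_ij) -[x]mulr1.
by apply: subspace_powM => //; apply: subspace_pow_one.
Qed.

Lemma subspace_pow_exhaust V : frame V -> forall x, exists n, subspace_pow V n x.
Proof.
move=> [_ V1 genV] x.
pose B : set A := [set x | exists n, subspace_pow V n x].
suff : B x by []; have : smallest (@subalgebra k A) V x by rewrite genV.
apply: smallest_sub; last first.
  move=> v Vv; exists 1%N; apply: sub_gen_smallest; exists (fun _ => v) => //.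
  by rewrite big_ord1.
split.
- by apply/mem_set; exists 0%N; apply: subspace_pow_one.
- move=> c a b /set_mem[i Va] /set_mem[j Vb]; apply/mem_set; exists (i + j)%N.
  have /submoduleP[_ Wl] : submodule (subspace_pow V (i + j)).
    exact: submodule_smallest.
  apply: Wl; first exact: subspace_pow_le (leq_addr _ _) Va.
  exact: subspace_pow_le (leq_addl _ _) Vb.
- move=> a b /set_mem[i Va] /set_mem[j Vb]; apply/mem_set; exists (i + j)%N.
  exact: subspace_powM.
Qed.

Variables (T : finType) (X : monomial_basis A T).

(** The matrix of the words in a basis of [U] has the matrix of the coefficient
    functions as a right inverse. *)
Lemma size_words_le_dim (U : set A) m (ws : seq (seq T)) : has_dim U m ->
  uniq ws -> (forall w, w \in ws -> lang X w /\ U (mon X w)) ->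
  (size ws <= m)%N.
Proof.
move=> [b [_ ->]] uws Hws.
have nthP (i : 'I_(size ws)) : nth [::] ws i \in ws by apply: mem_nth.
have /choice[c Hc] : forall i : 'I_(size ws), exists c : 'I_m -> k,
    \sum_(j < m) c j *: b j = mon X (nth [::] ws i).
  by move=> i; have [_ [c _ E]] := Hws _ (nthP i); exists c.
pose C : 'M[k]_(size ws, m) := \matrix_(i, j) c i j.
pose D : 'M[k]_(m, size ws) := \matrix_(j, l) coef X (nth [::] ws l) (b j).
apply: (@mulmx1_min _ _ _ C D); apply/matrixP => i l.
have -> : (C *m D) i l = coef X (nth [::] ws l) (mon X (nth [::] ws i)).
  rewrite -Hc raddf_sum /= mxE; apply: eq_bigr => j _.
  by rewrite linearZ /= !mxE.
rewrite coef_lang_mon; last by have [] := Hws _ (nthP l).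
by rewrite mxE nth_uniq // eq_sym.
Qed.

(** The matrix of coefficients of a basis of [U] is row free, since coefficients
    determine an element. *)
Lemma dim_le_size_words (U : set A) m (ws : seq (seq T)) : has_dim U m ->
  (forall x w, U x -> coef X w x != 0 -> w \in ws) -> (m <= size ws)%N.
Proof.
move=> [b [free_b EU]] Hws.
pose M : 'M[k]_(m, size ws) := \matrix_(i, j) coef X (nth [::] ws j) (b i).
have /eqP <- : row_free M; last exact: rank_leq_col.
rewrite -kermx_eq0; apply/rowV0P => v /sub_kermxP vM.
suff H : \sum_(i < m) v 0 i *: b i = 0.
  by apply/rowP => i; rewrite mxE (free_b _ H).
apply: (coef_ext (X := X)) => w; rewrite raddf0.
have [ws_w|/negP nws] := boolP (w \in ws); last first.
  apply/eqP; apply: contrapT => /negP nz; apply: nws; apply: Hws nz.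
  by rewrite EU; exists (v 0).
have lt_w : (index w ws < size ws)%N by rewrite index_mem.
have := congr1 (fun N : 'rV[k]_(size ws) => N 0 (Ordinal lt_w)) vM.
rewrite !mxE => E; rewrite raddf_sum /= -[RHS]E; apply: eq_bigr => i _.
by rewrite linearZ /= mxE /= nth_index.
Qed.

Lemma frame_words V : frame V -> exists2 m, (0 < m)%N &
  forall w, subspace_pow V (m * size w) (mon X w).
Proof.
move=> fV; have [_ V1 _] := fV.
have /choice[n Hn] : forall x : T, exists n, subspace_pow V n (mon X [:: x]).
  by move=> x; apply: subspace_pow_exhaust.
exists (\sum_x n x).+1 => // w.
elim: w => [|x w IHw]; first by rewrite mon_nil; apply: subspace_pow_one.
rewrite /= mulnS -cat1s mon_cat; apply: subspace_powM => //.
by apply: subspace_pow_le (Hn x) => //; rewrite (bigD1 x) //= -addnS leq_addr.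
Qed.

Lemma frame_support V : frame V -> exists l, forall n x w,
  subspace_pow V n x -> coef X w x != 0 -> (size w <= l * n)%N.
Proof.
move=> [[m [b [_ EV]]] _ _].
have /choice[s Hs] : forall i : 'I_m, exists s : seq (seq T),
    forall w, coef X w (b i) != 0 -> w \in s.
  by move=> i; have [s _ Hs] := coef_support X (b i); exists s.
pose l := (\max_(i < m) \max_(w <- s i) size w)%N; exists l.
have Vl x w : V x -> coef X w x != 0 -> (size w <= l)%N.
  rewrite EV => -[c _ <-]; rewrite raddf_sum /= => nz.
  have [i nzi] : exists i, coef X w (b i) != 0.
    apply: contrapT => H; case/eqP: nz; rewrite big1 // => i _.
    rewrite linearZ /=; apply/eqP; rewrite mulf_eq0; apply/orP; right.
    by apply: contrapT => /negP nzi; apply: H; exists i.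
  apply: leq_trans (leq_bigmax i).
  exact: (leq_bigmax_seq (F := size) w (Hs _ _ nzi)).
move=> n x w Vx; pose U : set A := [set x | forall w, coef X w x != 0 -> (size w <= l * n)%N].
suff : U x by apply. apply: (smallest_sub _ _ Vx).
  apply/submoduleP; split=> [v|c a d Ua Ud v] /=; first by rewrite raddf0 eqxx.
  rewrite linearP /=; have [->|nz _] := eqVneq (coef X v a) 0; last exact: Ua.
  by rewrite mulr0 add0r; apply: Ud.
move=> _ [v Vv <-] /= {}w; elim: n v Vv {Vx U} w => [|n IHn] v Vv w.
  rewrite big_ord0 => nz; move: (nz); rewrite coef_one; last exact: coef_lang nz.
  by have [->|_] := eqVneq w [::]; rewrite ?eqxx.
rewrite big_ord_recr /= => /coefM_split[u [u' [-> nz nz']]].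
rewrite size_cat mulnS addnC leq_add //; first exact: Vl nz'.
by apply: IHn nz => i; apply: Vv.
Qed.

(** The words of length at most [n] are linearly independent in [V ^ (m * n)]. *)
Lemma quadratic_growth_bound (R : realType) : quadratic_growth A R ->
  exists C, quadratic_bound (lang X) C.
Proof.
move=> [V fV [C1 [C2 [_ C2_gt0 H]]]]; have [m m_gt0 Hm] := frame_words fV.
have [_ V1 _] := fV.
exists (Num.bound (C2 * m%:R ^+ 2)) => n n_gt0.
have mn_gt0 : (0 < m * n)%N by rewrite muln_gt0 m_gt0.
have [r dimr /andP[_ le_r]] := H _ mn_gt0.
have le1 : (size (words_upto (lang X) n) <= r)%N.
  apply: size_words_le_dim dimr (uniq_words_upto _ _) _ => w.
  rewrite mem_words_upto => /andP[/set_mem Lw le_w]; split=> //.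
  by apply: subspace_pow_le (Hm w) => //; rewrite leq_mul2l le_w orbT.
rewrite -(ler_nat R) natrM natrX; apply: le_trans (_ : r%:R <= _).
  by rewrite ler_nat.
apply: le_trans le_r _; rewrite natrM exprMn mulrA ler_wpM2r ?exprn_ge0 //.
by apply: ltW; apply: archi_boundP; rewrite mulr_ge0 ?exprn_ge0 // ltW.
Qed.

(** [V ^ n] is contained in the span of the words of length at most [l * n]. *)
Lemma quadratic_growth_superlinear (R : realType) : quadratic_growth A R ->
  forall D, exists2 n, (0 < n)%N & (D * n < size (words_upto (lang X) n))%N.
Proof.
move=> [V fV [C1 [C2 [C1_gt0 _ H]]]] D; have [l Hl] := frame_support fV.
apply: contrapT => nD.
have linear n : (0 < n)%N -> (size (words_upto (lang X) n) <= D * n)%N.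
  by move=> n_gt0; rewrite leqNgt; apply/negP => lt; apply: nD; exists n.
pose n := (Num.bound ((D * l.+1)%:R / C1)).+1.
have [r dimr /andP[ge_r _]] := H n isT.
have le1 : (r <= D * (l.+1 * n))%N.
  apply: leq_trans (linear (l.+1 * n)%N isT).
  apply: dim_le_size_words dimr _ => x w Vx nz; rewrite mem_words_upto.
  rewrite mem_set /=; last exact: coef_lang nz.
  by apply: leq_trans (Hl _ _ _ Vx nz) _; rewrite leq_mul2r leqnSn orbT.
have le2 : C1 * n%:R ^+ 2 <= (D * (l.+1 * n))%:R.
  by apply: le_trans ge_r _; rewrite ler_nat.
move: le2; rewrite mulnA natrM expr2 mulrA ler_pM2r ?ltr0n // leNgt => /negP; apply.
rewrite mulrC -ltr_pdivrMr //; apply: lt_trans (archi_boundP _) _.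
  by rewrite divr_ge0 // ltW.
by rewrite ltr_nat.
Qed.

End FramePowers.

(** * The locally nilpotent ideal *)

Lemma dropl_cat (T : Type) n (u v : seq T) :
  (n <= size u)%N -> drop n (u ++ v) = drop n u ++ v.
Proof.
move=> le_n; rewrite drop_cat; case: ltnP => // ge_n.
have -> : n = size u by apply/eqP; rewrite eqn_leq le_n.
by rewrite subnn drop0 drop_size.
Qed.

(** Some piece starts inside [v] at a position at most [l], and it ends at a
    position at most [2 * l]. *)
Lemma infix_flatten (T : eqType) (fs : seq (seq T)) v l : (0 < l)%N ->
  (forall f, f \in fs -> (0 < size f <= l)%N) -> (2 * l <= size v)%N ->
  infix v (flatten fs) -> exists2 f, f \in fs & infix f v.
Proof.
move=> l_gt0 + le_v; elim: fs => [|f fs IHfs] Hfs /infixP[p [q]] /= E.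
  by have := congr1 size E; rewrite !size_cat /=; lia.
have [le_fp|lt_pf] := leqP (size f) (size p).
  have [||g gfs gv] := IHfs.
  - by move=> g gfs; apply: Hfs; rewrite inE gfs orbT.
  - apply/infixP; exists (drop (size f) p), q.
    by have := congr1 (drop (size f)) E; rewrite drop_size_cat // dropl_cat.
  - by exists g; rewrite // inE gfs orbT.
have {}E : drop (size p) f ++ flatten fs = v ++ q.
  have := congr1 (drop (size p)) E.
  by rewrite [RHS](drop_size_cat _ (erefl (size p))) dropl_cat // ltnW.
have /andP[_ le_f] := Hfs f (mem_head _ _).
case: fs => [|f' fs] in Hfs E {IHfs} *.
  have := congr1 size E; rewrite /= !size_cat size_drop /=; lia.
have /andP[_ le_f'] : (0 < size f' <= l)%N by apply: Hfs; rewrite !inE eqxx orbT.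
exists f'; first by rewrite !inE eqxx orbT.
set r := drop (size p) f ++ f'.
have le_r : (size r <= size v)%N by rewrite size_cat size_drop; lia.
have Er : r = take (size r) v.
  by rewrite -(takel_cat q le_r) -E /= catA take_size_cat.
apply: (infix_trans (suffix_infix (drop (size p) f) f')).
by rewrite -/r Er infix_take.
Qed.

Section NilIdeal.
Variables (k : fieldType) (A : algType k) (T : finType).
Variable X : monomial_basis A T.
Hypothesis iL : infinite_lang (lang X).

(** These are the words that span the Jacobson radical. *)
Definition transient w : Prop :=
  lang X w /\ forall K, minimal_lang K -> K `<=` lang X -> ~ K w.

Definition transient_ideal : set A :=
  [set a | forall w, coef X w a != 0 -> transient w].

Lemma transient_nonempty w : transient w -> w <> [::].
Proof.
move=> [_ nK] E; have [K mK KL] := minimal_lang_below iL.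
by apply: (nK K mK KL); rewrite E; apply: infinite_lang_nil mK.1.
Qed.

Lemma transient_catl u w : transient w -> lang X (u ++ w) -> transient (u ++ w).
Proof.
move=> [_ nK] Luw; split=> // K mK KL Kuw; apply: (nK K mK KL).
exact: factorial_catr mK.1.1 Kuw.
Qed.

(** Otherwise the factors of such products would contain a minimal language, whose
    long words contain an entire member of [F]. *)
Lemma transient_products (F : seq (seq T)) : (forall f, f \in F -> transient f) ->
  exists n, forall fs, {subset fs <= F} -> lang X (flatten fs) -> (size fs < n)%N.
Proof.
move=> HF.
pose K : set (seq T) :=
  [set v | lang X v /\ exists2 fs, {subset fs <= F} & infix v (flatten fs)].
have fK : factorial K.
  move=> u v uv [Lv [fs sub vfs]]; split; first exact: lang_factorial uv Lv.
  by exists fs => //; apply: infix_trans vfs.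
pose l := (\max_(f <- F) size f).+1.
have sizeF f : f \in F -> (0 < size f <= l)%N.
  move=> fF; rewrite /l (leqW (leq_bigmax_seq (F := size) f fF _)) // andbT.
  by have := transient_nonempty (HF _ fF); case: (f).
have niK : ~ infinite_lang K.
  move=> iK; have [K' mK' K'K] := minimal_lang_below iK.
  have [v K'v sv] := mK'.1.2 (2 * l)%N; have [_ [fs sub vfs]] := K'K _ K'v.
  have [|||f ffs fv] := infix_flatten (l := l) _ _ _ vfs => //; last first.
  - have [_ nK] := HF _ (sub _ ffs); apply: (nK K' mK').
      by move=> w /K'K[].
    exact: mK'.1.1 fv K'v.
  - by rewrite sv.
  - by move=> f /sub /sizeF.
have [n Hn] := finite_langP fK niK; exists n => fs sub Lfs.
apply: leq_ltn_trans (Hn (flatten fs) _); last first.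
  by split=> //; exists fs => //; apply: infix_refl.
elim: fs sub {Lfs} => //= f fs IHfs sub; rewrite size_cat -add1n leq_add //.
  by have /andP[] := sizeF f (sub _ (mem_head _ _)).
by apply: IHfs => g gfs; apply: sub; rewrite inE gfs orbT.
Qed.

Lemma transient_ideal_locally_nilpotent : locally_nilpotent transient_ideal.
Proof.
move=> s sI.
have [F HF sF] : exists2 F : seq (seq T), forall f, f \in F -> transient f &
    forall a, a \in s -> forall w, coef X w a != 0 -> w \in F.
  elim: s sI => [|a s IHs] sI; first by exists [::].
  have [|F HF sF] := IHs; first by move=> b bs; apply: sI; rewrite /= inE bs orbT.
  have [t _ Ht] := coef_support X a.
  exists ([seq w <- t | coef X w a != 0] ++ F).
    move=> w; rewrite mem_cat mem_filter => /orP[/andP[nz _]|/HF//].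
    by apply: (sI a) nz; rewrite /= mem_head.
  move=> b; rewrite inE => /predU1P[->|bs] w nz; rewrite mem_cat.
    by rewrite mem_filter nz Ht.
  by rewrite (sF _ bs _ nz) orbT.
have [n Hn] := transient_products HF.
pose D m : set A := [set a | forall w, coef X w a != 0 ->
  exists fs, [/\ {subset fs <= F}, (m <= size fs)%N & w = flatten fs]].
have DM i j a b : D i a -> D j b -> D (i + j)%N (a * b).
  move=> Da Db w /coefM_split[u [v [-> /Da[fs [sub le -> ]] /Db[gs [sub' le' ->]]]]].
  exists (fs ++ gs); rewrite size_cat flatten_cat leq_add //; split=> // f.
  by rewrite mem_cat => /orP[/sub|/sub'].
have D0 a : D n a -> a = 0.
  move=> Da; apply: (coef_ext (X := X)) => w; rewrite raddf0; apply/eqP.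
  apply: contrapT => /negP nz; have [fs [sub le E]] := Da _ nz.
  by have := Hn fs sub; rewrite -E ltnNge le => /(_ (coef_lang nz)).
have subD : smallest (@nonunital_subalgebra k A) [set` s] `<=` D 1%N.
  apply: smallest_sub; last first.
    by move=> a /= /sF Ha w /Ha wF; exists [:: w]; rewrite /= cats0; split=> // f; rewrite inE => /eqP->.
  split.
    apply/submoduleP; split=> [w|c a b Da Db w]; first by rewrite raddf0 eqxx.
    rewrite linearP /=; have [->|nz _] := eqVneq (coef X w a) 0; last exact: Da.
    by rewrite mulr0 add0r; apply: Db.
  move=> a b /set_mem Da /set_mem Db; apply/mem_set => w /(DM _ _ _ _ Da Db)[fs [sub le ->]].
  by exists fs; split=> //; apply: leq_trans le.
exists n.+1 => // v Bv.
(* [D m] consists of combinations of products of at least [m] words of [F]. *)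
have prodD m (u : 'I_m -> A) : (forall i, D 1%N (u i)) -> D m (\prod_(i < m) u i).
  elim: m u => [|m IHm] u Du.
    rewrite big_ord0 => w nz; exists [::]; split=> //; apply/eqP.
    apply: contraNT nz => /negPf w0.
    by rewrite -(mon_nil X) coef_mon w0 andbF.
  rewrite big_ord_recr /=; have := DM m 1%N; rewrite addn1; apply=> //.
  exact: IHm.
rewrite big_ord_recr /= (D0 (\prod_(i < n) v (widen_ord (leqnSn n) i))) ?mul0r //.
by apply: prodD => i; apply: subD.
Qed.

Lemma transient_mon_jacobson w : transient w -> jacobson_radical A (mon X w).
Proof.
move=> tw; apply: nil_left_ideal_jacobson => a.
have [|n _ Hn] := @transient_ideal_locally_nilpotent [:: a * mon X w].
  move=> b; rewrite /= inE => /eqP -> z nz; have Lz := coef_lang nz.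
  by have [u E] := coef_mul_mon_split nz; rewrite E in Lz *; apply: transient_catl.
exists n; have := Hn (fun _ => a * mon X w); rewrite prodr_const card_ord; apply.
by move=> _; apply: sub_gen_smallest; rewrite /= inE.
Qed.

(** A word of [A] avoiding each of finitely many proper sublanguages is found by
    joining words that avoid them one by one. *)
Lemma transient_exists C : quadratic_bound (lang X) C -> recurrent (lang X) ->
  ~ minimal_lang (lang X) -> exists w, transient w.
Proof.
move=> quadL rL nmL; have [Ks HKs] := finitely_many_minimal quadL iL rL.
have [w Lw Hw] : exists2 w, lang X w & forall K, K \in Ks -> minimal_lang K ->
    K `<=` lang X -> ~ K w.
  elim: Ks {HKs} => [|K Ks [w Lw Hw]].
    by exists [::] => //; apply: infinite_lang_nil.
  have [[mK KL]|nK] := pselect (minimal_lang K /\ K `<=` lang X); last first.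
    by exists w => // K'; rewrite inE => /predU1P[-> mK KL|/Hw//]; case: nK.
  have [v Lv nKv] : exists2 v, lang X v & ~ K v.
    apply: contrapT => H; apply: nmL; suff -> : lang X = K by [].
    apply/seteqP; split=> // v Lv; apply: contrapT => nKv; apply: H.
    by exists v.
  have [x Lx] := rL _ _ Lw Lv; exists (w ++ x ++ v) => // K'.
  rewrite inE => /predU1P[-> _ _|K's mK' K'L Kx].
    by rewrite catA => /(factorial_catr mK.1.1).
  by apply: (Hw K' K's mK' K'L); apply: factorial_catl mK'.1.1 Kx.
by exists w; split=> // K mK KL; apply: Hw => //; apply: HKs.
Qed.

Lemma jacobson_radical_transient C : quadratic_bound (lang X) C ->
  jacobson_radical A `<=` transient_ideal.
Proof.
move=> quadL f Jf w nz; split; first exact: coef_lang nz.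
move=> K mK KL Kw; case/eqP: nz.
exact: (jacobson_radical_coef mK KL (quadratic_bound_sub KL quadL) Kw Jf).
Qed.

Lemma jacobson_radical_locally_nilpotent C : quadratic_bound (lang X) C ->
  locally_nilpotent (jacobson_radical A).
Proof.
move=> quadL s sJ; apply: transient_ideal_locally_nilpotent.
exact: subset_trans sJ (jacobson_radical_transient quadL).
Qed.

Lemma jacobson_radical_neq0 C : quadratic_bound (lang X) C -> recurrent (lang X) ->
  ~ minimal_lang (lang X) -> jacobson_radical A <> [set 0].
Proof.
move=> quadL rL nmL E; have [w tw] := transient_exists quadL rL nmL.
have := transient_mon_jacobson tw; rewrite E => /= mw0.
by have [] := tw; rewrite /lang /= mw0 eqxx.
Qed.

(** * Primitivity when the language is minimal *)

Definition letter_sum : A := \sum_x mon X [:: x].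

Lemma coef_letter_sum w : lang X w -> coef X w letter_sum = (size w == 1%N)%:R.
Proof.
move=> Lw; rewrite /letter_sum raddf_sum /=.
under eq_bigr do rewrite coef_lang_mon //.
case: w Lw => [|x [|y w]] Lw; first by rewrite big1.
  rewrite (bigD1 x) //= eqxx big1 ?addr0 // => y nyx.
  by rewrite eqseq_cons andbT eq_sym (negPf nyx).
by rewrite big1 // => z _; rewrite eqseq_cons andbF.
Qed.

Lemma coef_letter_sum_exp n w : lang X w ->
  coef X w (letter_sum ^+ n) = (size w == n)%:R.
Proof.
elim: n w => [|n IHn] w Lw; first by rewrite expr0 coef_one // size_eq0.
rewrite exprS coefM //.
have E i : coef X (take i w) letter_sum * coef X (drop i w) (letter_sum ^+ n) =
    ((size (take i w) == 1%N) && (size w - i == n)%N)%:R.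
  have Lt := factorial_take i (@lang_factorial _ _ _ X) Lw.
  have Ld := factorial_drop i (@lang_factorial _ _ _ X) Lw.
  by rewrite coef_letter_sum // IHn // size_drop -natrM mulnb.
under eq_bigr do rewrite E.
case: w Lw {E} => [|x w] Lw; first by rewrite big_ord1.
rewrite (bigD1 (lift ord0 ord0)) //= subSS subn0 take0 eqSS big1 ?addr0 // => i ni.
rewrite size_takel; last by have := ltn_ord i.
by have -> : (i == 1 :> nat)%N = false by apply: contraNF ni => /eqP E; apply/eqP/val_inj.
Qed.

(** When the language of [A] is itself minimal but not periodic, every nonzero
    ideal contains all long words. *)
Lemma minimal_lang_primitive C : quadratic_bound (lang X) C ->
  minimal_lang (lang X) ->
  (forall D, exists2 n, (0 < n)%N & (D * n < size (words_upto (lang X) n))%N) ->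
  primitive_ring A.
Proof.
move=> quadL mL superlinear.
apply: (@primitive_of_power_in_ideals _ letter_sum) => [b|I idI [f If f0]].
  exact: (sub_one_not_left_invertible_uniform mL _ (N := 1) _ coef_letter_sum).
have [w nz] : exists w, coef X w f != 0.
  apply: contrapT => H; apply: f0; apply: (coef_ext (X := X)) => w.
  by rewrite raddf0; apply/eqP; apply: contrapT => /negP nz; apply: H; exists w.
have [|[v [g [v0 Lv _ _ _]]]] :=
    ideal_dichotomy mL (@subset_refl _ _) quadL idI If (coef_lang nz) nz.
  move=> [N _ [g Ig Hg]]; exists N; suff <- : g = letter_sum ^+ N by [].
  apply: (coef_ext (X := X)) => z; have [Lz|nLz] := pselect (lang X z).
    by rewrite Hg // coef_letter_sum_exp.
  have coef0 a : coef X z a = 0.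
    by apply/eqP; apply: contrapT => /negP /coef_lang.
  by rewrite !coef0.
have v_gt0 : (0 < size v)%N by case: (v) v0.
have [D HD] := periodic_linear_growth v_gt0 (commutes_sub_periodic mL v0 Lv).
by have [n n_gt0] := superlinear D; rewrite ltnNge HD.
Qed.

End NilIdeal.

(** * Algebras spanned by words *)

Section WordSpan.
Variables (k : fieldType) (B : algType k) (T : finType) (e : seq T -> B).
Hypotheses (e_nil : e [::] = 1) (e_cat : forall u v, e (u ++ v) = e u * e v).
Hypothesis e_span : forall b, exists s (c : seq T -> k),
  b = \sum_(w <- s) c w *: e w.

Local Notation L := [set w | e w != 0].

Lemma word_span_factorial : factorial L.
Proof.
move=> u w /infixP[p [q ->]] /=; apply: contraNN => /eqP eu0.
by rewrite !e_cat eu0 mul0r mulr0.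
Qed.

Lemma word_span_recurrent : prime_ring B -> recurrent L.
Proof.
move=> prB u v /= eu0 ev0; apply: contrapT => H.
have [|/eqP|/eqP] := prime_ringP prB (x := e u) (y := e v); last 2 first.
- by rewrite (negPf eu0).
- by rewrite (negPf ev0).
move=> b; have [s [c ->]] := e_span b.
rewrite mulr_sumr mulr_suml big1 // => w _.
rewrite -scalerAr -scalerAl -!e_cat -catA.
have [->|nz] := eqVneq (e (u ++ w ++ v)) 0; first by rewrite scaler0.
by case: H; exists w.
Qed.

(** If all nonzero words have period [n], reading a word of length [n + 1]
    cyclically shows that the sum of the words of length [n] is central; and
    multiplying a word of length at least [n] by it prepends one period. *)
Definition period_sum n : B := \sum_(t : n.-tuple T) e t.

Section Periodic.
Variable n : nat.
Hypotheses (n_gt0 : (0 < n)%N) (perL : forall w, L w -> period n w).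

Lemma period_sum_letter x : period_sum n * e [:: x] = e [:: x] * period_sum n.
Proof.
rewrite /period_sum mulr_suml mulr_sumr.
have rotI : injective (@rot_tuple n 1 T).
  by move=> t t' /(congr1 val) /= /rot_inj /val_inj.
rewrite [RHS](reindex_inj rotI) /=; apply: eq_bigr => t _.
rewrite -!e_cat; case: (tval t) (size_tuple t) => [|y u] /= su.
  by have := n_gt0; rewrite -su.
rewrite rot1_cons; have [-> |nxy] := eqVneq x y; first by rewrite -cats1.
have zero a b : a != b -> e (a :: rcons u b) = 0.
  move=> nab; apply/eqP; apply: contrapT => /negP nz.
  have pW : period n (a :: rcons u b) by apply: perL.
  have := pW a 0%N.
  rewrite add0n -su /= size_rcons ltnSn nth_rcons ltnn eqxx => /(_ isT) E.
  by rewrite E eqxx in nab.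
by rewrite cats1 !zero // eq_sym.
Qed.

Lemma period_sum_central : central (period_sum n).
Proof.
have H w : period_sum n * e w = e w * period_sum n.
  elim: w => [|x w IHw]; first by rewrite e_nil mulr1 mul1r.
  by rewrite -cat1s e_cat mulrA period_sum_letter -!mulrA IHw.
move=> b; have [s [c ->]] := e_span b; rewrite mulr_sumr mulr_suml.
by apply: eq_bigr => w _; rewrite -scalerAr H scalerAl.
Qed.

Lemma period_sum_mul v w : size v = n -> (n <= size w)%N -> e (v ++ w) != 0 ->
  e (v ++ w) = period_sum n * e w.
Proof.
move=> sv le_n nz; rewrite /period_sum mulr_suml.
have Ev u : size u = n -> e (u ++ w) != 0 -> u = take n w.
  move=> su /perL pu; case: u => [|x0 u'] in su pu *.
    by have := n_gt0; rewrite -su.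
  set u := x0 :: u' in su pu *.
  apply: (@eq_from_nth _ x0); first by rewrite size_takel.
  move=> i; rewrite su => lt_i; rewrite nth_take //.
  have := pu x0 i; rewrite size_cat su addnC ltn_add2l => /(_ (leq_trans lt_i le_n)).
  by rewrite !nth_cat su lt_i ltnNge leq_addr /= addKn.
have tv : size v == n by rewrite sv.
rewrite (bigD1 (Tuple tv)) //= -e_cat big1 ?addr0 // => t ntv.
rewrite -e_cat; apply/eqP; apply: contrapT => /negP nzt; case/eqP: ntv.
by apply: val_inj; rewrite /= (Ev _ sv nz) (Ev _ _ nzt) ?size_tuple.
Qed.

Definition short_word M : finType := {l : 'I_(2 * M) & l.-tuple T}.

Lemma periodic_central_span M : (n <= M)%N ->
  forall b, exists2 c : short_word M -> B, forall i, central (c i) &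
    b = \sum_i c i * e (tagged i).
Proof.
move=> le_nM.
have central0 : central (0 : B) by move=> x; rewrite mul0r mulr0.
have word w : exists2 c : short_word M -> B, forall i, central (c i) &
    e w = \sum_i c i * e (tagged i).
  have [m] := ubnP (size w); elim: m w => // m IHm w; rewrite ltnS => le_m.
  have [->|nz] := eqVneq (e w) 0.
    by exists (fun _ => 0) => //; rewrite big1 // => i _; rewrite mul0r.
  have [lt_w|le_w] := ltnP (size w) (2 * M).
    pose i0 : short_word M := @Tagged _ (Ordinal lt_w) (fun l : 'I_(2 * M) => l.-tuple T) (in_tuple w).
    exists (fun i => (i == i0)%:R).
      by move=> i; case: (i == i0) => x //; rewrite mul1r mulr1.
    rewrite (bigD1 i0) //= eqxx mul1r big1 ?addr0 // => i /negPf->.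
    by rewrite mul0r.
  rewrite -(cat_take_drop n w) in nz *.
  have le_nw : (n <= size w)%N by lia.
  have [|c cc E] := IHm (drop n w); first by rewrite size_drop; lia.
  exists (fun i => period_sum n * c i).
    by move=> i x; rewrite -mulrA cc !mulrA period_sum_central.
  rewrite period_sum_mul ?size_takel // ?size_drop; last by lia.
  by rewrite E mulr_sumr; apply: eq_bigr => i _; rewrite mulrA.
move=> b; have [s [a ->]] := e_span b.
elim: s => [|w s [c cc IHs]].
  by exists (fun _ => 0) => //; rewrite big_nil big1 // => i _; rewrite mul0r.
have [c' cc' E] := word w; exists (fun i => a w *: c' i + c i).
  by move=> i x; rewrite mulrDl mulrDr cc -scalerAl cc' scalerAr.
rewrite big_cons IHs E scaler_sumr -big_split /=; apply: eq_bigr => i _.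
by rewrite mulrDl scalerAl.
Qed.

End Periodic.
End WordSpan.

(** * Simple finite-dimensional images *)

Section PrimeImage.
Variables (k : fieldType) (B : falgType k) (T : finType) (e : seq T -> B).
Hypotheses (e_nil : e [::] = 1) (e_cat : forall u v, e (u ++ v) = e u * e v).
Hypothesis e_span : forall b, exists s (c : seq T -> k),
  b = \sum_(w <- s) c w *: e w.
Hypothesis prB : prime_ring B.
Variable C : nat.

Local Notation L := [set w | e w != 0].
Hypothesis quadL : quadratic_bound L C.

Lemma exists_min_rank : exists w, [/\ L w &
  forall v, L v -> (\dim (<[e w]> * fullv)%VS <= \dim (<[e v]> * fullv)%VS)%N].
Proof.
pose P r := `[< exists2 w, L w & \dim (<[e w]> * fullv)%VS = r >].
have P0 : exists r, P r.
  by exists (\dim (<[e [::]]> * fullv)%VS); apply/asboolP; exists [::] => //=; rewrite e_nil oner_eq0.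
case: (ex_minnP P0) => r /asboolP[w Lw sw] minr; exists w; split=> // v Lv.
by rewrite sw; apply: minr; apply/asboolP; exists v.
Qed.

(** Let [w] have minimal rank.  If [w x w] is nonzero then left multiplication by
    [w x] maps the right ideal [w B] onto itself; hence all products of such words
    [w x] are nonzero, and they must commute because of the growth of [L]. *)
Lemma prime_image_periodic : exists2 n, (0 < n)%N & forall v, L v -> period n v.
Proof.
have fL : factorial L by exact: word_span_factorial e_cat.
have rL : recurrent L by exact: word_span_recurrent e_cat e_span prB.
have [[y Ly y0]|triv] := pselect (exists2 y, L y & y <> [::]); last first.
  exists 1%N => // v Lv x0 i; suff -> : v = [::] by [].
  by apply: contrapT => v0; apply: triv; exists v.
have [w [Lw minw]] := exists_min_rank.
pose P := (<[e w]> * fullv)%VS.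
pose ret u := exists2 x, u = w ++ x & L (u ++ w).
have retP u : ret u -> (<[e u]> * P)%VS = P.
  move=> [x -> Lu]; apply/eqP; rewrite eqEdim; apply/andP; split.
    rewrite e_cat -prodv_line -prodvA; apply: prodvSr; exact: subvf.
  by apply: leq_trans (minw _ Lu) _; rewrite [e (_ ++ w)]e_cat -prodv_line -prodvA.
have nP : P != 0%VS.
  apply/negP => /eqP E; have : e w * 1 \in P by rewrite memv_mul ?memv_line ?memvf.
  by rewrite E memv0 mulr1; apply/negP.
have flat us : (forall u, u \in us -> ret u) -> L (flatten us).
  move=> Hus; suff EP : (<[e (flatten us)]> * P)%VS = P.
    by apply/negP => /eqP E; move: nP; rewrite -EP E prod0v eqxx.
  elim: us Hus => [|u us IHus] Hus /=.
    by rewrite e_nil prod1v.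
  rewrite e_cat -prodv_line -prodvA IHus ?retP //.
    by apply: Hus; rewrite mem_head.
  by move=> v vus; apply: Hus; rewrite inE vus orbT.
have comm u v : ret u -> ret v -> commutes u v.
  move=> ru rv; apply: (free_products_commute quadL) => us sub; apply: flat => z zus.
  by have := sub z zus; rewrite !inE => /orP[] /eqP->.
have through v : L v -> exists a b, ret (w ++ a ++ v ++ b).
  move=> Lv; have [a La] := rL _ _ Lw Lv; have [b Lb] := rL _ _ La Lw.
  exists a, b; exists (a ++ v ++ b) => //; by move: Lb; rewrite -!catA.
have [a [b ry]] := through y Ly.
set u := w ++ a ++ y ++ b in ry.
exists (size u); first by rewrite /u !size_cat; case: (y) y0 => // *; rewrite !addnS.
move=> v Lv; have [a' [b' rv]] := through v Lv.
apply: period_infix (commutes_period (comm _ _ rv ry)).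
by rewrite catA infix_infix.
Qed.

End PrimeImage.

Section BoundedImages.
Variables (k : fieldType) (A : algType k) (T : finType).
Variable X : monomial_basis A T.

Lemma mon_image_span (B : algType k) (f : {lrmorphism A -> B}) :
  (forall b, exists a, f a = b) ->
  forall b, exists s (c : seq T -> k), b = \sum_(w <- s) c w *: f (mon X w).
Proof.
move=> surjf b; have [a <-] := surjf b; have [s _ E] := mon_span X a.
exists s, (fun w => coef X w a); rewrite {1}E raddf_sum.
by apply: eq_bigr => w _; rewrite /= linearZ_LR.
Qed.

Lemma lang_recurrent : prime_ring A -> recurrent (lang X).
Proof.
apply: word_span_recurrent; first exact: mon_cat.
move=> a; have [s _ E] := mon_span X a.
by exists s, (fun w => coef X w a).
Qed.

(** The language of a finite-dimensional prime image is periodic.  Unless it is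
    reduced to the empty word, it is therefore one of the finitely many minimal
    languages inside that of [A], which bounds the period. *)
Lemma monomial_bounded_matrix_images C : quadratic_bound (lang X) C ->
  infinite_lang (lang X) -> recurrent (lang X) -> bounded_matrix_images A.
Proof.
move=> quadL iL rL; have [Ks HKs] := finitely_many_minimal quadL iL rL.
pose has_period n (K : set (seq T)) := (0 < n)%N /\ forall v, K v -> period n v.
have [M HM] : exists M, forall K, K \in Ks -> (exists n, has_period n K) ->
    exists2 n, has_period n K & (n <= M)%N.
  elim: Ks {HKs} => [|K Ks [M HM]]; first by exists 0%N.
  have [[n Hn]|nper] := pselect (exists n, has_period n K).
    exists (n + M)%N => K'; rewrite inE => /predU1P[-> _|K's per].
      by exists n; rewrite // leq_addr.
    by have [n' Hn' le] := HM _ K's per; exists n'; rewrite // (leq_trans le) ?leq_addl.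
  by exists M => K'; rewrite inE => /predU1P[-> //|/HM].
pose I := short_word T M.+1.
exists #|{: I}|.+1 => // B f surjf prB.
pose e w := f (mon X w).
have e_nil : e [::] = 1 by rewrite /e mon_nil rmorph1.
have e_cat u v : e (u ++ v) = e u * e v by rewrite /e mon_cat rmorphM.
have e_span : forall b, exists s (c : seq T -> k), b = \sum_(w <- s) c w *: e w.
  exact: mon_image_span.
pose L' : set (seq T) := [set w | e w != 0].
have L'L : L' `<=` lang X.
  by move=> w; apply: contraNN => /eqP E; rewrite /e E raddf0.
have fL' : factorial L' by exact: word_span_factorial e_cat.
have rL' : recurrent L' by exact: word_span_recurrent e_cat e_span prB.
have [n n_gt0 per_n] := prime_image_periodic e_nil e_cat e_span prB (quadratic_bound_sub L'L quadL).
have [n' [n'_gt0 per'] le_n'] : exists2 n', has_period n' L' & (n' <= M.+1)%N.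
  have [ne|triv] := pselect (exists2 w, L' w & w <> [::]).
    have iL' := recurrent_infinite fL' rL' ne.
    have mL' := periodic_recurrent_minimal n_gt0 iL' rL' per_n.
    have [|n' Hn' le] := HM _ (HKs _ mL' L'L); first by exists n.
    by exists n'; rewrite // (leq_trans le).
  exists 1%N => //; split=> // v Lv x0 i; suff -> : v = [::] by [].
  by apply: contrapT => v0; apply: triv; exists v.
apply: (@standard_identity_central_span _ I (fun i => e (tagged i))).
  exact: (periodic_central_span e_nil e_cat e_span n'_gt0 per' le_n').
lia.
Qed.

End BoundedImages.

Theorem corollary1p5 (R : realType) (k : fieldType) (A : algType k)
  (hfg : finitely_generated_algebra A)
  (hprime : prime_ring A)
  (hmon : monomial_algebra A)
  (hgrowth : quadratic_growth A R) :
  bounded_matrix_images A /\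
  (primitive_ring A \/
   (jacobson_radical A <> [set 0] /\
    locally_nilpotent (jacobson_radical A))).
Proof.
have [d [X]] := monomial_algebra_basis hmon.
have [C quadL] := quadratic_growth_bound X hgrowth.
have superlinear := quadratic_growth_superlinear X hgrowth.
have rL : recurrent (lang X) := lang_recurrent hprime.
have iL : infinite_lang (lang X).
  apply: (recurrent_infinite (@lang_factorial _ _ _ X) rL).
  apply: contrapT => triv; have [n n_gt0] := superlinear 1%N.
  apply/negP; rewrite -leqNgt mul1n.
  suff le1 : (size (words_upto (lang X) n) <= size [:: [::] : seq 'I_d])%N by apply: leq_trans le1 _.
  apply: uniq_leq_size (uniq_words_upto _ _) _ => w.
  rewrite mem_words_upto => /andP[/set_mem Lw _]; rewrite inE; apply/eqP.
  by apply: contrapT => w0; apply: triv; exists w.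
split; first exact: monomial_bounded_matrix_images quadL iL rL.
have [mL|nmL] := pselect (minimal_lang (lang X)); [left | right].
  exact: minimal_lang_primitive quadL mL superlinear.
split; first exact (jacobson_radical_neq0 iL quadL rL nmL).
exact (jacobson_radical_locally_nilpotent iL quadL).
Qed.
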